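(* Let $\mathcal{M}_1(0,1)$ be the set of Borel probability measures on $(0,1)$ with the weak$^*$ topology. The map $\psi:(\mathrm{RDS}(I),d_m)\to\mathcal{M}_1(0,1)$ which assigns to each $f\in\mathrm{RDS}(I)$ its unique stationary probability measure $\mu_f$ on $(0,1)$ is continuous.
   Context: Let $I=[0,1]$. Define $h:(0,1)\to\mathbb{R}$ by $h(x)=\log(x)-\log(1/2)$ for $x\in(0,1/2]$ and $h(x)=\log(1/2)-\log(1-x)$ for $x\in[1/2,1)$, and put $d_h(x,y)=|h(x)-h(y)|$. Let $\mathrm{C}(I)$ be the set of continuous functions $f$ from $I$ onto $I$ such that $f(0)=0$, $f(1)=1$, $f((0,1))\subset(0,1)$, and the (one-sided) derivatives $f'(0),f'(1)$ exist and lie in $(0,\infty)$. It carries the metric $d_{\mathrm{C}(I)}(f,g)=\sup_{x\in(0,1)}d_h(f(x),g(x))$ (which is always finite). Let $\mathrm{RDS}(I)$ be the set of triples $f=(f_0,f_1,p_f)\in\mathrm{C}(I)\times\mathrm{C}(I)\times[0,1]$ such that: (i) $f_0,f_1$ are homeomorphisms; (ii) $f_0(x)<x$ for all $x\in(0,1)$; (iii) $f_1(x)>x$ for all $x\in(0,1)$; (iv) $p_f\in(0,1)$; (v) for $j\in\{0,1\}$, $\Lambda_j=p_f\log f_0'(j)+(1-p_f)\log f_1'(j)>0$. It carries the metric $d_m(f,g)=\max\{d_{\mathrm{C}(I)}(f_0,g_0),d_{\mathrm{C}(I)}(f_1,g_1),|p_f-p_g|\}$. A Borel probability measure $\mu$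 on $(0,1)$ is stationary for $f\in\mathrm{RDS}(I)$ if $\mu(A)=p_f\,\mu(f_0^{-1}(A))+(1-p_f)\,\mu(f_1^{-1}(A))$ for every Borel set $A\subset(0,1)$. It is a known fact that each $f\in\mathrm{RDS}(I)$ has exactly one stationary Borel probability measure on $(0,1)$, denoted $\mu_f$. Weak$^*$ convergence $\mu_n\to\mu$ in $\mathcal{M}_1(0,1)$ means $\int\xi\,d\mu_n\to\int\xi\,d\mu$ for every bounded continuous $\xi:(0,1)\to\mathbb{R}$. *)

(* Defs.v *)
From HB Require Import structures.
From mathcomp Require Import all_boot all_order all_algebra.
From mathcomp Require Import all_classical all_reals all_analysis.
From mathcomp Require Import lra.

Set Implicit Arguments.
Unset Strict Implicit.
Unset Printing Implicit Defensive.
Import Order.TTheory GRing.Theory Num.Theory.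
Import numFieldNormedType.Exports.
Local Open Scope classical_set_scope.
Local Open Scope ring_scope.

Notation Icc R := (set_type (`[0, 1]%classic : set R)).
Notation Ioo R := (set_type (`]0, 1[%classic : set R)).

Section points.
Context {R : realType}.

Definition iccval (x : Icc R) : R := \val x.
Definition iooval (x : Ioo R) : R := \val x.

Lemma iccval_itv (x : Icc R) : 0 <= iccval x <= 1.
Proof. by case: x => x xI; have := set_mem xI; rewrite /= in_itv. Qed.

Lemma iooval_itv (x : Ioo R) : 0 < iooval x < 1.
Proof. by case: x => x xI; have := set_mem xI; rewrite /= in_itv. Qed.

Lemma iccval_inj : injective iccval.
Proof. exact: val_inj. Qed.

Lemma iooval_inj : injective iooval.
Proof. exact: val_inj. Qed.

Lemma mem_Icc (x : R) : 0 <= x <= 1 -> x \in (`[0, 1]%classic : set R).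
Proof. by move=> x01; apply: mem_set; rewrite /= in_itv. Qed.

Lemma mem_Ioo (x : R) : 0 < x < 1 -> x \in (`]0, 1[%classic : set R).
Proof. by move=> x01; apply: mem_set; rewrite /= in_itv. Qed.

Definition icc_of (x : R) (x01 : 0 <= x <= 1) : Icc R := exist _ x (mem_Icc x01).
Definition ioo_of (x : R) (x01 : 0 < x < 1) : Ioo R := exist _ x (mem_Ioo x01).

Lemma le001 : 0 <= (0 : R) <= 1. Proof. by rewrite lexx ler01. Qed.
Lemma le011 : 0 <= (1 : R) <= 1. Proof. by rewrite lexx ler01. Qed.
Lemma half_itv : 0 < (2^-1 : R) < 1.
Proof. by rewrite invr_gt0 ltr0n invf_lt1 ?ltr0n // ltr1n. Qed.

Definition icc0 : Icc R := icc_of le001.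
Definition icc1 : Icc R := icc_of le011.

Lemma ioo_icc_subproof (x : Ioo R) : 0 <= iooval x <= 1.
Proof. by have /andP[x0 x1] := iooval_itv x; rewrite !ltW. Qed.

Definition ioo_icc (x : Ioo R) : Icc R := icc_of (ioo_icc_subproof x).

End points.

HB.instance Definition _ (R : realType) :=
  isPointed.Build (Ioo R) (ioo_of half_itv).

Section hdist.
Context {R : realType}.

Definition h (x : R) : R :=
  if x <= 2^-1 then ln x - ln 2^-1 else ln 2^-1 - ln (1 - x).

Definition d_h (x y : R) : R := `|h x - h y|.

End hdist.

Section CI_def.
Context {R : realType}.

(* The limit of [diffq f a] along [a^'] is taken inside [0, 1], so at the
   endpoints it is the one-sided derivative. *)
Definition diffq (f : Icc R -> Icc R) (a x : Icc R) : R :=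
  (iccval (f x) - iccval (f a)) / (iccval x - iccval a).

Definition derivI (f : Icc R -> Icc R) (a : Icc R) : R := lim (diffq f a @ a^').

Record CI := mkCI {
  cfun :> Icc R -> Icc R ;
  cfun_continuous : continuous cfun ;
  cfun_onto : forall y, exists x, cfun x = y ;
  cfun0 : cfun icc0 = icc0 ;
  cfun1 : cfun icc1 = icc1 ;
  cfun_Ioo : forall x, 0 < iccval x < 1 -> 0 < iccval (cfun x) < 1 ;
  cfun_cvg0 : cvg (diffq cfun icc0 @ icc0^') ;
  cfun_cvg1 : cvg (diffq cfun icc1 @ icc1^') ;
  cfun_deriv0 : 0 < derivI cfun icc0 ;
  cfun_deriv1 : 0 < derivI cfun icc1 }.

Lemma cfun_inj (f g : CI) : cfun f =1 cfun g -> f = g.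
Proof.
case: f g => [f ? ? ? ? ? ? ? ? ?] [g ? ? ? ? ? ? ? ? ?] /= /funext fg.
by subst g; congr mkCI; exact: Prop_irrelevance.
Qed.

Lemma cfunI_subproof (f : CI) (x : Ioo R) : 0 < iccval (f (ioo_icc x)) < 1.
Proof. by apply: cfun_Ioo; exact: iooval_itv. Qed.

Definition cfunI (f : CI) (x : Ioo R) : Ioo R := ioo_of (cfunI_subproof f x).

(* The supremum is over a bounded set, see [has_sup_d_C]. *)
Definition d_C (f g : CI) : R :=
  sup [set d_h (iooval (cfunI f x)) (iooval (cfunI g x)) | x in [set: Ioo R]].

End CI_def.
Arguments CI : clear implicits.

Section d_C_metric.
Context {R : realType}.

Lemma iccval_continuous : continuous (@iccval R).
Proof. exact: initial_continuous. Qed.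

Lemma Icc_compact : compact [set: Icc R].
Proof.
move=> F FF _.
have F01 : (iccval @ F) `[0, 1]%classic.
  by apply: (@filterE _ F) => x /=; rewrite in_itv; exact: iccval_itv.
have [p [/= pI clp]] := @segment_compact R 0 1 (iccval @ F) _ F01.
rewrite in_itv /= in pI.
exists (icc_of pI); split => // A B FA [U [[V oV VU] Up] UB].
rewrite /= in VU; subst U.
have FA' : (iccval @ F) (iccval @` A).
  by apply: (@filterS _ F _ A) => // x Ax; exists x.
have [_ [[x Ax <-] Vy]] := clp _ _ FA' (open_nbhs_nbhs (conj oV Up)).
by exists x; split => //; apply: UB.
Qed.

Lemma ln_ratio_bounded (u w : Icc R -> R) (a : Icc R) (l : R) :
  continuous u -> continuous w ->
  (forall x, x != a -> 0 < u x) -> (forall x, x != a -> 0 < w x) ->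
  0 < l -> (u x / w x @[x --> a^']) --> l ->
  exists K, forall x, x != a -> `|ln (u x / w x)| <= K.
Proof.
move=> cu cw u0 w0 l0 uwl.
have /compact_near_coveringP cov := Icc_compact.
have H := cov R (pinfty_nbhs R)
  (fun K x => x != a -> `|ln (u x / w x)| <= K) _.
have : \forall K \near +oo, [set: Icc R] `<=`
    (fun x => x != a -> `|ln (u x / w x)| <= K).
  apply: H => x _.
  have [e [e0 He]] : exists e : R, 0 < e /\
      (\forall y \near x, y != a -> e^-1 <= u y / w y <= e).
    pose l' := if x == a then l else u x / w x.
    have l'0 : 0 < l'.
      by rewrite /l'; case: eqVneq => // xa; rewrite divr_gt0 ?u0 ?w0.
    have cvl' : \forall y \near x, y != a -> l' / 2 < u y / w y < l' * 2.
      have I1 : l' / 2 < l' by lra.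
      have I2 : l' < l' * 2 by lra.
      rewrite /l' in I1 I2 *; case: eqVneq I1 I2 => [-> | xa] I1 I2.
        have A1 := cvgr_gt _ uwl _ I1; have A2 := cvgr_lt _ uwl _ I2.
        rewrite near_withinE in A1; rewrite near_withinE in A2.
        by apply: (@filterS2 _ (nbhs a) _ _ _ _ _ (A1 _) (A2 _)) => y h1 h2 ya; rewrite h1 // h2.
      have FF := nbhs_filter x.
      have uwx : (u y / w y @[y --> x]) --> u x / w x.
        apply: (@cvgM _ _ _ FF); first exact: cu.
        by apply: (@cvgV _ _ _ FF); [rewrite gt_eqF ?w0 | exact: cw].
      have A1 := cvgr_gt _ uwx _ I1; have A2 := cvgr_lt _ uwx _ I2.
      by apply: (@filterS2 _ (nbhs x) _ _ _ _ _ (A1 FF) (A2 FF)) => y h1 h2 _; rewrite h1 // h2.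
    exists (l' * 2 + (l' / 2)^-1); split.
      by rewrite addr_gt0 ?invr_gt0 ?divr_gt0 ?mulr_gt0.
    apply: filterS cvl' => y Hy ya; have /andP[y1 y2] := Hy ya.
    have h1 : 0 < (l' / 2)^-1 by rewrite invr_gt0 divr_gt0.
    have h2 : 0 < l' * 2 by rewrite mulr_gt0.
    apply/andP; split; last by lra.
    apply: le_trans (ltW y1).
    rewrite -[leRHS]invrK lef_pV2 ?posrE ?addr_gt0 //; lra.
  exists ([set y | y != a -> e^-1 <= u y / w y <= e], [set K | ln e <= K]).
    by split => //=; apply: nbhs_pinfty_ge; exact: num_real.
  case=> y K /= [Hy HK] ya; have /andP[y1 y2] := Hy ya.
  have q0 : 0 < u y / w y by rewrite divr_gt0 ?u0 ?w0.
  apply: le_trans HK; rewrite ler_norml -lnV ?posrE // !ler_ln ?posrE ?invr_gt0 //.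
  by rewrite y1 y2.
move=> HK; near +oo_R => K.
have B : [set: Icc R] `<=` (fun x => x != a -> `|ln (u x / w x)| <= K) by near: K.
by exists K => x xa; exact: B.
Unshelve. all: by end_near.
Qed.

Lemma h_ln (x : R) : 0 < x < 1 -> `|h x - (ln x - ln (1 - x))| <= ln 2.
Proof.
move=> /andP[x0 x1]; have y0 : 0 < 1 - x by lra.
have E : ln (2^-1 : R) = - ln 2 by rewrite lnV ?posrE.
rewrite /h; case: (leP x) => x2; rewrite E.
  have : ln (1 - x) <= 0 by apply: ln_le0; lra.
  have : - ln 2 <= ln (1 - x) by rewrite -E ler_ln ?posrE //; lra.
  rewrite ler_norml; lra.
have : ln x <= 0 by apply: ln_le0; lra.
have : - ln 2 <= ln x by rewrite -E ler_ln ?posrE //; lra.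
rewrite ler_norml; lra.
Qed.

Lemma h_inj (x y : R) : 0 < x < 1 -> 0 < y < 1 -> h x = h y -> x = y.
Proof.
wlog xy : x y / x <= y.
  move=> H x01 y01 hxy; have [xy|/ltW yx] := leP x y; first exact: H.
  by apply/esym/H.
move=> /andP[x0 x1] /andP[y0 y1].
have a0 : 0 < 1 - x by lra.
have b0 : 0 < 1 - y by lra.
rewrite /h; case: (leP x) => x2; case: (leP y) => y2 hh.
- by apply: ln_inj; rewrite ?posrE //; lra.
- have : ln x <= ln (2^-1 : R) by rewrite ler_ln ?posrE //; lra.
  have : ln (1 - y) < ln (2^-1 : R) by rewrite ltr_ln ?posrE //; lra.
  lra.
- lra.
- suff : 1 - x = 1 - y by lra.
  by apply: ln_inj; rewrite ?posrE //; lra.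
Qed.

Lemma d_h_cfun_id (f : CI R) :
  exists K, forall x : Ioo R, d_h (iooval (cfunI f x)) (iooval x) <= K.
Proof.
have cf : continuous (fun x => iccval (f x)).
  by move=> x; apply: continuous_comp; [exact: cfun_continuous|exact: iccval_continuous].
have f01 (x : Icc R) : x != icc0 -> x != icc1 -> 0 < iccval (f x) < 1.
  move=> x0 x1; apply: cfun_Ioo; have /andP[a b] := iccval_itv x.
  rewrite !lt_neqAle a b !andbT; apply/andP; split.
    by apply: contra x0 => /eqP e; apply/eqP/iccval_inj; rewrite -e.
  by apply: contra x1 => /eqP e; apply/eqP/iccval_inj; rewrite e.
have [K0 HK0] : exists K, forall x, x != icc0 ->
    `|ln (iccval (f x) / iccval x)| <= K.
  apply: (@ln_ratio_bounded _ _ _ (derivI f icc0)) => //.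
  - exact: iccval_continuous.
  - move=> x x0; have [->|x1] := eqVneq x icc1; first by rewrite cfun1 /= ltr01.
    by have /andP[] := f01 x x0 x1.
  - move=> x x0; have /andP[a b] := iccval_itv x; rewrite lt_neqAle a andbT.
    by apply: contra x0 => /eqP e; apply/eqP/iccval_inj; rewrite -e.
  - exact: cfun_deriv0.
  - have E : diffq f icc0 = fun x => iccval (f x) / iccval x.
      by apply/funext => x; rewrite /diffq cfun0 /= !subr0.
    by have := @cfun_cvg0 _ f; rewrite /derivI E.
have [K1 HK1] : exists K, forall x, x != icc1 ->
    `|ln ((1 - iccval (f x)) / (1 - iccval x))| <= K.
  apply: (@ln_ratio_bounded _ _ _ (derivI f icc1)) => //.
  - by move=> x; apply: (@cvgB _ _ _ _ (nbhs_filter x)); [exact: cvg_cst|exact: cf].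
  - by move=> x; apply: (@cvgB _ _ _ _ (nbhs_filter x)); [exact: cvg_cst|exact: iccval_continuous].
  - move=> x x1; have [->|x0] := eqVneq x icc0.
      by rewrite cfun0 /= subr0 ltr01.
    by have /andP[] := f01 x x0 x1; rewrite subr_gt0.
  - move=> x x1; have /andP[a b] := iccval_itv x.
    rewrite subr_gt0 lt_neqAle b andbT.
    by apply: contra x1 => /eqP e; apply/eqP/iccval_inj; rewrite e.
  - exact: cfun_deriv1.
  - have E : diffq f icc1 = fun x => (1 - iccval (f x)) / (1 - iccval x).
      apply/funext => x; rewrite /diffq cfun1 /= -opprB.
      by rewrite -[X in _ / X]opprB invrN mulrNN.
    by have := @cfun_cvg1 _ f; rewrite /derivI E.
exists (K0 + K1 + (ln 2 + ln 2)) => x.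
have /andP[x0 x1] := iooval_itv x.
have /andP[y0 y1] := iooval_itv (cfunI f x).
have /h_ln Hx := iooval_itv x.
have /h_ln Hy := iooval_itv (cfunI f x).
have n0 : ioo_icc x != icc0.
  by apply/eqP => /(congr1 iccval) e; move: x0; rewrite [iooval x]e ltxx.
have n1 : ioo_icc x != icc1.
  by apply/eqP => /(congr1 iccval) e; move: x1; rewrite [iooval x]e ltxx.
have := HK0 _ n0; have := HK1 _ n1.
rewrite -[iccval (ioo_icc x)]/(iooval x) -[iccval (f _)]/(iooval (cfunI f x)).
move: (iooval (cfunI f x)) (iooval x) x0 x1 y0 y1 Hx Hy => y z z0 z1 y0 y1.
have z1' : 0 < 1 - z by rewrite subr_gt0.
have y1' : 0 < 1 - y by rewrite subr_gt0.
rewrite /d_h !ln_div ?posrE // !ler_norml.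
lra.
Qed.

Lemma d_h_triangle (y x z : R) : d_h x z <= d_h x y + d_h y z.
Proof. exact: ler_distD. Qed.

Lemma d_hC (x y : R) : d_h x y = d_h y x.
Proof. exact: distrC. Qed.

Lemma has_sup_d_C (f g : CI R) :
  has_sup [set d_h (iooval (cfunI f x)) (iooval (cfunI g x)) | x in [set: Ioo R]].
Proof.
split; first by exists (d_h (iooval (cfunI f point)) (iooval (cfunI g point))), point.
have [K HK] := d_h_cfun_id f; have [L HL] := d_h_cfun_id g.
exists (K + L) => _ [x _ <-].
by rewrite (le_trans (d_h_triangle (iooval x) _ _)) // lerD // d_hC.
Qed.

Lemma d_C_ub (f g : CI R) (x : Ioo R) :
  d_h (iooval (cfunI f x)) (iooval (cfunI g x)) <= d_C f g.
Proof. by apply: ub_le_sup; [exact: (has_sup_d_C f g).2|exists x]. Qed.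

Lemma d_C_le (f g : CI R) (K : R) :
  (forall x, d_h (iooval (cfunI f x)) (iooval (cfunI g x)) <= K) -> d_C f g <= K.
Proof.
move=> H; apply: ge_sup; first exact: (has_sup_d_C f g).1.
by move=> _ [x _ <-].
Qed.

Lemma d_C_ge0 (f g : CI R) : 0 <= d_C f g.
Proof. exact: le_trans (normr_ge0 _) (d_C_ub f g point). Qed.

Lemma d_Cxx (f : CI R) : d_C f f = 0.
Proof.
apply/eqP; rewrite eq_le d_C_ge0 andbT; apply: d_C_le => x.
by rewrite /d_h subrr normr0.
Qed.

Lemma d_C_positivity (f g : CI R) : d_C f g = 0 -> f = g.
Proof.
move=> fg0; apply: cfun_inj => x; apply: iccval_inj.
have [->|x0] := eqVneq x icc0; first by rewrite !cfun0.
have [->|x1] := eqVneq x icc1; first by rewrite !cfun1.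
have x01 : 0 < iccval x < 1.
  have /andP[a b] := iccval_itv x.
  rewrite !lt_neqAle a b !andbT; apply/andP; split.
    by apply: contra x0 => /eqP e; apply/eqP/iccval_inj; rewrite -e.
  by apply: contra x1 => /eqP e; apply/eqP/iccval_inj; rewrite e.
have -> : x = ioo_icc (ioo_of x01) by exact: iccval_inj.
apply: (h_inj (iooval_itv (cfunI f (ioo_of x01)))
              (iooval_itv (cfunI g (ioo_of x01)))).
apply/eqP; rewrite -subr_eq0 -normr_le0 -fg0.
exact: (d_C_ub f g).
Qed.

Lemma d_C_sym (f g : CI R) : d_C f g = d_C g f.
Proof.
by apply/eqP; rewrite eq_le; apply/andP; split; apply: d_C_le => x;
  rewrite d_hC; exact: d_C_ub.
Qed.

Lemma d_C_triangle (g f k : CI R) : d_C f k <= d_C f g + d_C g k.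
Proof.
apply: d_C_le => x; apply: le_trans (d_h_triangle (iooval (cfunI g x)) _ _) _.
by rewrite lerD ?d_C_ub.
Qed.

End d_C_metric.

HB.instance Definition _ (R : realType) := gen_eqMixin (CI R).
HB.instance Definition _ (R : realType) := gen_choiceMixin (CI R).
HB.instance Definition _ (R : realType) := @isMetric.Build R (CI R) d_C
  d_Cxx d_C_positivity d_C_sym d_C_triangle.

Section RDS_def.
Context {R : realType}.

Definition homeomorphism (f : Icc R -> Icc R) :=
  continuous f /\
  exists g : Icc R -> Icc R, [/\ continuous g, cancel f g & cancel g f].

Definition Lambda (f0 f1 : CI R) (p : R) (j : Icc R) : R :=
  p * ln (derivI f0 j) + (1 - p) * ln (derivI f1 j).

Record RDS := mkRDS {
  rds0 : CI R ;
  rds1 : CI R ;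
  rdsp : R ;
  rds0_homeo : homeomorphism rds0 ;
  rds1_homeo : homeomorphism rds1 ;
  rds0_lt : forall x : Icc R, 0 < iccval x < 1 -> iccval (rds0 x) < iccval x ;
  rds1_gt : forall x : Icc R, 0 < iccval x < 1 -> iccval x < iccval (rds1 x) ;
  rdsp_itv : 0 < rdsp < 1 ;
  rds_Lambda0 : 0 < Lambda rds0 rds1 rdsp icc0 ;
  rds_Lambda1 : 0 < Lambda rds0 rds1 rdsp icc1 }.

Lemma rds_inj (f g : RDS) :
  rds0 f = rds0 g -> rds1 f = rds1 g -> rdsp f = rdsp g -> f = g.
Proof.
case: f g => [f0 f1 p ? ? ? ? ? ? ?] [g0 g1 q ? ? ? ? ? ? ?] /= e0 e1 ep.
by subst g0 g1 q; congr mkRDS; exact: Prop_irrelevance.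
Qed.

Definition d_m (f g : RDS) : R :=
  Num.max (d_C (rds0 f) (rds0 g))
    (Num.max (d_C (rds1 f) (rds1 g)) `|rdsp f - rdsp g|).

Lemma d_mxx (f : RDS) : d_m f f = 0.
Proof. by rewrite /d_m !d_Cxx subrr normr0 !maxxx. Qed.

Lemma d_m_positivity (f g : RDS) : d_m f g = 0 -> f = g.
Proof.
move=> fg0; have : d_m f g <= 0 by rewrite fg0.
rewrite /d_m !ge_max => /and3P[h0 h1 hp]; apply: rds_inj.
- by apply: d_C_positivity; apply/eqP; rewrite eq_le h0 d_C_ge0.
- by apply: d_C_positivity; apply/eqP; rewrite eq_le h1 d_C_ge0.
- by apply/eqP; rewrite -subr_eq0 -normr_le0.
Qed.

Lemma d_m_sym (f g : RDS) : d_m f g = d_m g f.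
Proof.
by rewrite /d_m (d_C_sym (rds0 f)) (d_C_sym (rds1 f)) (distrC (rdsp f)).
Qed.

Lemma d_m_triangle (g f k : RDS) : d_m f k <= d_m f g + d_m g k.
Proof.
rewrite {1}/d_m !ge_max; apply/and3P; split.
- apply: le_trans (d_C_triangle (rds0 g) _ _) _.
  by rewrite lerD // /d_m le_max lexx.
- apply: le_trans (d_C_triangle (rds1 g) _ _) _.
  by rewrite lerD // /d_m !le_max lexx orbT.
- apply: le_trans (ler_distD (rdsp g) _ _) _.
  by rewrite lerD // /d_m !le_max lexx !orbT.
Qed.

End RDS_def.
Arguments RDS : clear implicits.

HB.instance Definition _ (R : realType) := gen_eqMixin (RDS R).
HB.instance Definition _ (R : realType) := gen_choiceMixin (RDS R).
HB.instance Definition _ (R : realType) := @isMetric.Build R (RDS R) d_m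
  d_mxx d_m_positivity d_m_sym d_m_triangle.

Notation borelIoo R := (g_sigma_algebraType (@open (Ioo R))).

Section M1_def.
Context {R : realType}.

Record bcfun := mkBcfun {
  bcfun_fun :> Ioo R -> R ;
  bcfun_continuous : continuous bcfun_fun ;
  bcfun_bounded : exists K : R, forall x, `|bcfun_fun x| <= K }.

(* Two elements of this type with the same values on Borel sets may still
   differ as functions on [set (Ioo R)]; neither [stationary] nor the topology
   below sees the difference. *)
Definition M1 : Type := probability (borelIoo R) R.

HB.instance Definition _ := Choice.on M1.

Definition weak_eval (xi : bcfun) (mu : M1) : R := \int[mu]_x xi x.

(* The coarsest topology for which all the integrals [weak_eval xi] are
   continuous; see [weak_cvgP]. *)
Definition weak_topology :=
  sup_topology (fun xi : bcfun =>
    Topological.on (initial_topology (weak_eval xi))).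

HB.instance Definition _ := Topological.copy M1 weak_topology.

Lemma weak_cvgP (F : set_system M1) (mu : M1) : Filter F ->
  F --> mu <->
  (forall xi : bcfun, weak_eval xi nu @[nu --> F] --> weak_eval xi mu).
Proof.
move=> FF; split.
  move=> /cvg_sup H xi U Umu; apply: (H xi).
  exact: (@initial_continuous _ _ (weak_eval xi)).
move=> H; apply/cvg_sup => xi U.
have /= -> := @nbhsE (initial_topology (weak_eval xi)) mu.
case=> B [[C oC <-] Cmu] /filterS; apply.
exact: (H xi _ (open_nbhs_nbhs (conj oC Cmu))).
Qed.

Definition stationary (f : RDS R) (mu : M1) :=
  forall A : set (borelIoo R), measurable A ->
    mu A = ((rdsp f)%:E * mu (cfunI (rds0 f) @^-1` A) +
            (1 - rdsp f)%:E * mu (cfunI (rds1 f) @^-1` A))%E.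

End M1_def.
Arguments M1 : clear implicits.

(* Main.v *)
(** The distribution function F_f(x) = mu_f((0, x]) satisfies
    F_f(x) = p_f F_f(f_0^-1 x) + (1 - p_f) F_f(f_1^-1 x).
    Near 0 the positive Lyapunov exponent makes a small power x^alpha strictly
    superharmonic for the walk x -> f_0^-1 x, f_1^-1 x, so F_g(x) is bounded by a
    multiple of x^alpha, uniformly for g near f; the end 1 is symmetric.  Hence
    the oscillation of (g, y) -> F_g(y) at (f, x), as a function of x, is upper
    semicontinuous and tends to 0 at both ends; by the equation above it is
    subharmonic for the walk of f.  If its maximum were positive, there would be
    a least point z where it is attained, and it would also be attained at
    f_1^-1 z < z.  So the oscillation vanishes, which gives
    F_g(x) -> F_f(x) for all x as g -> f, and therefore weak convergence. *)
Require Import Defs.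
From mathcomp Require Import all_boot all_order all_algebra.
From mathcomp Require Import all_classical all_reals all_analysis.
From mathcomp Require Import measurable_realfun ring lra.

Set Implicit Arguments.
Unset Strict Implicit.
Unset Printing Implicit Defensive.
Import Order.TTheory GRing.Theory Num.Theory.
Import numFieldNormedType.Exports.
Local Open Scope classical_set_scope.
Local Open Scope ring_scope.

(** * The maximum principle for oscillations *)

Section oscillation.
Context {R : realType} {T : Type} (D : T -> R).
Implicit Types (Phi : T -> R -> R) (x c : R).

(* [D g] plays the role of the distance from [g] to a base point. *)
Definition osc_le Phi x c := exists2 d, 0 < d &
  forall g g' y y', D g < d -> D g' < d -> `|y - x| < d -> `|y' - x| < d ->
    `|Phi g y - Phi g' y'| <= c.

Lemma osc_leW Phi x c c' : c <= c' -> osc_le Phi x c -> osc_le Phi x c'.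
Proof.
by move=> cc' [d d0 H]; exists d => // *; apply: le_trans cc'; apply: H.
Qed.

Lemma osc_le_near Phi x c : osc_le Phi x c ->
  exists2 d, 0 < d & forall y, `|y - x| < d -> osc_le Phi y c.
Proof.
move=> [d d0 H]; exists (d / 2); first by rewrite divr_gt0.
move=> y yx; exists (d / 2); first by rewrite divr_gt0.
move=> g g' z z' Dg Dg' zy zy'.
have tri w : `|w - y| < d / 2 -> `|w - x| < d.
  by move: yx; rewrite !ltr_norml => /andP[? ?] /andP[? ?]; apply/andP; split; lra.
by apply: H; rewrite ?tri //; lra.
Qed.

Definition jointly_continuous (a : T -> R -> R) (a0 : R -> R) :=
  forall x e, 0 < x < 1 -> 0 < e -> exists2 d, 0 < d &
    forall g y, D g < d -> `|y - x| < d -> `|a g y - a0 x| < e.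

Variables (Phi : T -> R -> R) (p : T -> R) (p0 : R).
Variables (a b : T -> R -> R) (a0 b0 : R -> R).
Hypothesis Phi01 : forall g x, 0 <= Phi g x <= 1.
Hypothesis p001 : 0 < p0 < 1.
Hypothesis pcvg : forall g, `|p g - p0| <= D g.
Hypothesis harmonic : forall g x, 0 < x < 1 ->
  Phi g x = p g * Phi g (a g x) + (1 - p g) * Phi g (b g x).
Hypothesis acvg : jointly_continuous a a0.
Hypothesis bcvg : jointly_continuous b b0.

(** Subtracting two instances of [harmonic] leaves a mean with weights [p0] and [1 - p0], controlled
    by the oscillations at [a0 x] and [b0 x], plus an error from replacing [p g] and [p g'] by [p0].
    That error is small because [Phi] takes values in [0, 1]. *)
Lemma osc_le_subharmonic x ca cb e : 0 < x < 1 -> 0 < e ->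
  osc_le Phi (a0 x) ca -> osc_le Phi (b0 x) cb ->
  osc_le Phi x (p0 * ca + (1 - p0) * cb + e).
Proof.
have /andP[/ltW p00 /ltW p1] := p001.
have p10 : 0 <= 1 - p0 by rewrite subr_ge0.
move=> x01 e0 [da da0 Ha] [db db0 Hb].
have [d1 d10 H1] := acvg x01 da0.
have [d2 d20 H2] := bcvg x01 db0.
(* The terms [x] and [1 - x] keep [y] and [y'] in (0, 1), where [harmonic] applies; [e / 2] bounds
   each of the two errors in the weights. *)
pose d := Num.min (Num.min (Num.min da db) (Num.min d1 d2))
            (Num.min (e / 2) (Num.min x (1 - x))).
have d0 : 0 < d by rewrite !lt_min da0 db0 d10 d20 divr_gt0 //=; lra.
exists d => // g g' y y'.
rewrite !lt_min => /and3P[/andP[/andP[ga gb] /andP[g1 g2]] ge _].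
move=> /and3P[/andP[/andP[ga' gb'] /andP[g1' g2']] ge' _].
move=> /and3P[/andP[/andP[ya yb] /andP[y1 y2]] ye /andP[yx yx1]].
move=> /and3P[/andP[/andP[ya' yb'] /andP[y1' y2']] ye' /andP[yx' yx1']].
have y01 : 0 < y < 1 by move: yx yx1; rewrite !ltr_norml; lra.
have y01' : 0 < y' < 1 by move: yx' yx1'; rewrite !ltr_norml; lra.
rewrite (harmonic g y01) (harmonic g' y01').
have HA := Ha _ _ _ _ ga ga' (H1 _ _ g1 y1) (H1 _ _ g1' y1').
have HB := Hb _ _ _ _ gb gb' (H2 _ _ g2 y2) (H2 _ _ g2' y2').
move: HA HB (Phi01 g (a g y)) (Phi01 g (b g y)) (Phi01 g' (a g' y')) (Phi01 g' (b g' y')).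
move: (Phi g (a g y)) (Phi g (b g y)) (Phi g' (a g' y')) (Phi g' (b g' y')) => A B A' B'.
move=> HA HB A01 B01 A01' B01'; clear H1 H2 Ha Hb.
have -> : p g * A + (1 - p g) * B - (p g' * A' + (1 - p g') * B') =
  p0 * (A - A') + (1 - p0) * (B - B') + ((p g - p0) * (A - B) - (p g' - p0) * (A' - B')).
  by ring.
have err q u v : 0 <= u <= 1 -> 0 <= v <= 1 -> D q < e / 2 -> `|(p q - p0) * (u - v)| <= e / 2.
  move=> u01 v01 De; rewrite normrM -[leRHS]mulr1 ler_pM //.
    by apply: le_trans (ltW De); exact: pcvg.
  by rewrite ler_norml; lra.
apply: le_trans (ler_normD _ _) _; apply: lerD.
  apply: le_trans (ler_normD _ _) _; rewrite !normrM (ger0_norm p00) (ger0_norm p10).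
  by apply: lerD; rewrite ler_wpM2l.
apply: le_trans (ler_normB _ _) _; rewrite [leRHS](splitr e).
by apply: lerD; apply: err.
Qed.

Hypothesis a001 : forall x, 0 < x < 1 -> 0 < a0 x < 1.
Hypothesis b0x : forall x, 0 < x < 1 -> 0 < b0 x < x.
Hypothesis tail0 : forall e, 0 < e ->
  exists2 u, 0 < u < 1 & forall x, 0 < x < u -> osc_le Phi x e.
Hypothesis tail1 : forall e, 0 < e ->
  exists2 v, 0 < v < 1 & forall x, v < x < 1 -> osc_le Phi x e.

(* Maximum principle: the supremum of the oscillation, if positive, would be
   attained at a least point [z]; by subharmonicity it would then also be
   attained at [b0 z < z]. *)
Lemma osc_le_small x e : 0 < x < 1 -> 0 < e -> osc_le Phi x e.
Proof.
move=> x01 e0; apply: contrapT => nosc.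
(* [C] collects the uniform bounds on the oscillation, so its infimum [m] is the supremum of the
   oscillation over (0, 1). *)
pose C := [set c | forall y, 0 < y < 1 -> osc_le Phi y c].
have lbC : lbound C e.
  move=> c Cc; rewrite leNgt; apply/negP => ce; apply: nosc.
  by apply: osc_leW (ltW ce) _; apply: Cc.
have C1 : C 1.
  move=> y y01; exists 1 => // g g' w w' _ _ _ _.
  by have := Phi01 g w; have := Phi01 g' w'; rewrite ler_norml; lra.
have hiC : has_inf C by split; [exists 1 | exists e].
set m := inf C.
have m0 : 0 < m by apply: lt_le_trans e0 _; apply: lb_le_inf => //; exists 1.
have oscM c y : m < c -> 0 < y < 1 -> osc_le Phi y c.
  move=> mc y01; have [c' Cc' c'c] := inf_lt hiC.1 mc.
  by apply: osc_leW (ltW c'c) _; apply: Cc'.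
have nC c : c < m -> ~ C c.
  move=> cm Cc; have : m <= c by apply: ge_inf => //; exists e.
  by rewrite leNgt cm.
have m20 : 0 < m / 2 by rewrite divr_gt0.
have [u u01 Hu] := tail0 m20; have [v v01 Hv] := tail1 m20.
(* One bound below [m] must serve all of (0, s]; the supremum [z] of [S] is therefore the first
   point where the oscillation could reach [m]. *)
pose S := [set s | 0 < s < 1 /\ exists2 c, c < m & forall y, 0 < y <= s -> osc_le Phi y c].
have Su : S (u / 2).
  split; first by lra.
  by exists (m / 2); [lra | move=> y y0; apply: Hu; lra].
(* Past [v] the oscillation is at most [m / 2], so a point of [S] beyond [v] would give a uniform
   bound below [m]. *)
have Sv s : S s -> s <= v.
  move=> [s01 [c cm Hc]]; rewrite leNgt; apply/negP => vs.
  apply: (@nC (Num.max c (m / 2))); first by rewrite gt_max cm; lra.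
  move=> y y01; have [ys|sy] := leP y s.
    by apply: (@osc_leW _ _ c); [rewrite le_max lexx | apply: Hc; lra].
  by apply: (@osc_leW _ _ (m / 2)); [rewrite le_max lexx orbT | apply: Hv; lra].
have hsS : has_sup S by split; [exists (u / 2) | exists v].
set z := sup S.
have uz : u / 2 <= z by apply: ub_le_sup => //; exists v.
have zv : z <= v by apply: ge_sup => //; exists (u / 2).
have z01 : 0 < z < 1 by lra.
have /andP[bz0 bzz] := b0x z01.
have [s [s01 [c1 c1m H1]] bzs] := sup_gt (ex_intro _ _ Su) bzz.
have Hb : osc_le Phi (b0 z) c1 by apply: H1; rewrite bz0 ltW.
have /andP[p00 p11] := p001.
(* [q] is the drop below [m] contributed by [b0 z]. At [a0 z] only bounds above [m] are available,
   which costs at most [q / 4]; subharmonicity costs another [q / 4], and a drop of [q / 2]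
   remains. *)
pose q := (1 - p0) * (m - c1).
have q0 : 0 < q by rewrite mulr_gt0; lra.
have Ha : osc_le Phi (a0 z) (m + q / 4) by apply: oscM; [lra | apply: a001].
have q4 : 0 < q / 4 by lra.
have Hz : osc_le Phi z (m - q / 2).
  apply: osc_leW (osc_le_subharmonic z01 q4 Ha Hb).
  have -> : p0 * (m + q / 4) + (1 - p0) * c1 + q / 4 = m - q + p0 * (q / 4) + q / 4.
    by rewrite /q; ring.
  have : p0 * (q / 4) <= q / 4 by rewrite ger_pMl //; lra.
  lra.
have [d d0 Hd] := osc_le_near Hz.
have zdz : z - d / 2 < z by lra.
have [s' [s01' [c2 c2m H2]] zs'] := sup_gt (ex_intro _ _ Su) zdz.
(* The bound at [z] holds within distance [d], so it bridges from [s'] to a point [t] beyond [z],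
   against [z = sup S]. The second term keeps [t] below 1. *)
pose t := Num.min (z + d / 2) ((1 + z) / 2).
have zt : z < t by rewrite /t lt_min; lra.
suff : S t.
  move=> St; have : t <= z by apply: ub_le_sup => //; exists v.
  by rewrite leNgt zt.
have td : t <= z + d / 2 by rewrite /t ge_min lexx.
have t1 : t <= (1 + z) / 2 by rewrite /t ge_min lexx orbT.
split; first by lra.
exists (Num.max c2 (m - q / 2)); first by rewrite gt_max c2m; lra.
move=> y /andP[y0 yt]; have [ys|sy] := leP y s'.
  by apply: (@osc_leW _ _ c2); [rewrite le_max lexx | apply: H2; rewrite y0].
apply: (@osc_leW _ _ (m - q / 2)); first by rewrite le_max lexx orbT.
by apply: Hd; rewrite ltr_norml; lra.
Qed.

End oscillation.

(** * Decay of harmonic functions *)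

Section superharmonic.
Context {R : realType}.

(* Comparison with the strictly superharmonic function [x |-> (x / x0) ^ al];
   no attained maximum is needed since [F] vanishes at [0]. *)
Lemma harmonic_le_powR (F a b : R -> R) (p al rho x0 : R) :
  (forall x, F x <= 1) ->
  (forall e, 0 < e -> exists2 u, 0 < u & forall x, 0 < x < u -> F x <= e) ->
  0 <= p <= 1 ->
  (forall x, 0 < x < 1 -> F x = p * F (a x) + (1 - p) * F (b x)) ->
  (forall x, 0 < x < 1 -> 0 < a x < 1) -> (forall x, 0 < x < 1 -> 0 < b x < 1) ->
  0 < al -> rho < 1 -> 0 < x0 <= 1 ->
  (forall x, 0 < x < x0 -> p * a x `^ al + (1 - p) * b x `^ al <= rho * x `^ al) ->
  forall x, 0 < x < x0 -> F x <= (x / x0) `^ al.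
Proof.
move=> F1 F0 p01 harm a01 b01 al0 rho1 x001 powsup x xx0.
pose W x := (x / x0) `^ al.
have [x0p x0le1] : 0 < x0 /\ x0 <= 1 by apply/andP.
have WE y : 0 < y -> W y = y `^ al * (x0^-1) `^ al.
  by move=> y0; rewrite /W powRM // ?invr_ge0 ltW.
have Wge1 y : x0 <= y -> 1 <= W y.
  move=> xy; have <- : 1 `^ al = 1 :> R by rewrite powR1.
  apply: ge0_ler_powR; rewrite ?nnegrE //; first exact: ltW.
    by rewrite divr_ge0 ?ltW //; exact: lt_le_trans xy.
  by rewrite ler_pdivlMr // mul1r.
have Wmono y y' : 0 < y -> y <= y' -> W y <= W y'.
  move=> y0 yy'; have y'0 : 0 < y' by exact: lt_le_trans yy'.
  apply: ge0_ler_powR; rewrite ?nnegrE ?divr_ge0 ?(ltW al0) ?(ltW y0) ?(ltW y'0) ?(ltW x0p) //.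
  by rewrite ler_pM2r ?invr_gt0.
have Wgt0 y : 0 < y -> 0 < W y by move=> y0; rewrite powR_gt0 // divr_gt0.
have supW y : 0 < y < x0 -> p * W (a y) + (1 - p) * W (b y) <= rho * W y.
  move=> yx; have y01 : 0 < y < 1 by lra.
  have /andP[ay _] := a01 _ y01; have /andP[by_ _] := b01 _ y01; have /andP[y0 _] := y01.
  rewrite !WE // !mulrA -mulrDl ler_pM2r; first exact: powsup.
  by rewrite powR_gt0 // invr_gt0.
rewrite -/(W x) leNgt; apply/negP => lt.
pose E := [set t | exists2 y, 0 < y < x0 & t = F y - W y].
have ubE : ubound E 1.
  by move=> _ [y /andP[y0 _] ->]; have := F1 y; have := Wgt0 _ y0; lra.
have Ex : E (F x - W x) by exists x.
have hsE : has_sup E by split; [exists (F x - W x) | exists 1].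
set m := sup E.
have m0 : 0 < m.
  by apply: (@lt_le_trans _ _ (F x - W x)); [lra | apply: ub_le_sup => //; exists 1].
(* Beyond [x0] the comparison function is at least 1, hence [F - W] is nonpositive there; this
   covers [a y] and [b y] when they leave (0, x0). *)
have mub y : 0 < y < 1 -> F y - W y <= m.
  move=> /andP[y0 y1]; have [yx|xy] := ltP y x0.
    by apply: ub_le_sup; [exists 1 | exists y; rewrite ?y0].
  by have := F1 y; have := Wge1 _ xy; lra.
have m20 : 0 < m / 2 by lra.
have [u u0 Hu] := F0 _ m20.
(* A point within [e] of the supremum [m] cannot lie below [u], where [F] is at most [m / 2], nor
   above it, where strict superharmonicity gains at least [(1 - rho) * W u]. *)
set e := Num.min (m / 2) ((1 - rho) * W u).
have e0 : 0 < e by rewrite lt_min m20 mulr_gt0 ?Wgt0 //; lra.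
have me : m - e < m by lra.
have [_ [y /andP[y0 yx0] ->] meE] := sup_gt (ex_intro _ _ Ex) me.
have [yu|uy] := ltP y u.
  have : F y <= m / 2 by apply: Hu; rewrite y0.
  have : e <= m / 2 by rewrite /e ge_min lexx.
  by have := Wgt0 _ y0; lra.
have eW : e <= (1 - rho) * W u by rewrite /e ge_min lexx orbT.
have : (1 - rho) * W u <= (1 - rho) * W y by rewrite ler_pM2l ?Wmono //; lra.
have y01 : 0 < y < 1 by rewrite y0 (lt_le_trans yx0).
have yx : 0 < y < x0 by rewrite y0.
have := supW _ yx; have Ey := harm _ y01.
have : p * (F (a y) - W (a y)) <= p * m.
  by rewrite ler_wpM2l ?mub ?a01 //; lra.
have : (1 - p) * (F (b y) - W (b y)) <= (1 - p) * m.
  by rewrite ler_wpM2l ?mub ?b01 //; lra.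
lra.
Qed.

(** Inverting [1 - u <= expR (- u)] bounds [expR u] by [(1 - u)^-1], and comparing this with the
    quadratic reduces to [0 <= u ^+ 2 * (1 - 2 * u)]. *)
Lemma expR_le_quad (u : R) : `|u| <= 2^-1 -> expR u <= 1 + u + 2 * u ^+ 2.
Proof.
rewrite ler_norml => /andP[u1 u2].
have eN : 1 - u <= expR (- u) by have := expR_ge1Dx (- u); lra.
have : expR u <= (1 - u)^-1.
  by rewrite -[expR u]invrK -expRN lef_pV2 ?posrE ?expR_gt0 //; lra.
move/le_trans; apply; rewrite -[leLHS]mul1r ler_pdivrMr; last by lra.
have -> : (1 + u + 2 * u ^+ 2) * (1 - u) = 1 + u ^+ 2 * (1 - 2 * u) by ring.
have : 0 <= u ^+ 2 * (1 - 2 * u) by rewrite mulr_ge0 ?sqr_ge0 //; lra.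
lra.
Qed.

(* [al] is an exponent at which the moment generating function of the step
   with values [u0, u1] and mean [<= - L] is less than [1]. *)
Lemma exponent_exists (u0 u1 L : R) : 0 < L ->
  exists al rho, [/\ 0 < al, rho < 1 & forall p, 0 <= p <= 1 ->
    p * u0 + (1 - p) * u1 <= - L ->
    p * expR (al * u0) + (1 - p) * expR (al * u1) <= rho].
Proof.
move=> L0; pose K := `|u0| + `|u1| + 1.
have K0 : 1 <= K by rewrite /K -[leLHS]add0r lerD ?addr_ge0.
(* The first term gives [al * K <= 2^-1], so that [expR_le_quad] applies; the second makes the
   quadratic term at most [al * L / 2], half of the linear gain [al * L]. *)
pose al := Num.min (2 * K)^-1 (L / (4 * K ^+ 2)).
have al0 : 0 < al.
  by rewrite lt_min invr_gt0 divr_gt0 ?mulr_gt0 ?exprn_gt0 //; lra.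
exists al, (1 - al * L / 2); split=> //.
  have : 0 < al * L by rewrite mulr_gt0.
  lra.
move=> p p01 pL.
have K00 : 0 < K by lra.
have alK : al * K <= 2^-1.
  have : al <= (2 * K)^-1 by rewrite /al ge_min lexx.
  rewrite invfM; move/(ler_wpM2r (ltW K00)); rewrite -mulrA mulVf ?mulr1 //; lra.
have alK2 : 4 * K ^+ 2 * al <= L.
  have : al <= L / (4 * K ^+ 2) by rewrite /al ge_min lexx orbT.
  by rewrite ler_pdivlMr ?mulr_gt0 ?exprn_gt0 // mulrC.
have bnd u : `|u| <= K -> expR (al * u) <= 1 + al * u + al * L / 2.
  move=> uK; have auK : `|al * u| <= al * K.
    by rewrite normrM (gtr0_norm al0) ler_pM2l.
  apply: le_trans (expR_le_quad (le_trans auK alK)) _.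
  rewrite lerD2l exprMn.
  have : u ^+ 2 <= K ^+ 2.
    rewrite -[u ^+ 2]ger0_norm ?sqr_ge0 // normrX.
    by rewrite lerXn2r ?nnegrE ?normr_ge0 //; lra.
  move/(ler_wpM2l (ltW al0))/(ler_wpM2l (ltW al0)) => h1.
  have h2 := ler_wpM2l (ltW al0) alK2.
  lra.
have B0 : expR (al * u0) <= 1 + al * u0 + al * L / 2.
  by apply: bnd; rewrite /K -addrA lerDl addr_ge0.
have B1 : expR (al * u1) <= 1 + al * u1 + al * L / 2.
  by apply: bnd; rewrite /K addrAC lerDr addr_ge0.
have p0 : 0 <= p by lra.
have p1 : 0 <= 1 - p by lra.
have h0 := ler_wpM2l p0 B0; have h1 := ler_wpM2l p1 B1.
have h2 := ler_wpM2l (ltW al0) pL.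
lra.
Qed.

End superharmonic.

(** * Inverses of the fibre maps *)

Section real_extension.
Context {R : realType}.
Implicit Types (x y : R) (f g : CI R).

Lemma clamp_itv x : 0 <= Num.max 0 (Num.min x 1) <= 1.
Proof. by rewrite le_max lexx /= ge_max ler01 /= ge_min lexx orbT. Qed.

Definition clamp x : Icc R := icc_of (clamp_itv x).

Lemma clampK x : 0 <= x <= 1 -> iccval (clamp x) = x.
Proof. by move=> /andP[x0 x1]; rewrite /iccval /= (min_idPl x1) (max_idPr x0). Qed.

Lemma iccvalK (x : Icc R) : clamp (iccval x) = x.
Proof. by apply: iccval_inj; rewrite clampK // iccval_itv. Qed.

Lemma clamp_continuous : continuous clamp.
Proof.
apply: continuous_comp_initial => x; rewrite /comp /=.
apply: (@continuous_max _ _ (fun=> 0) (fun y : R => Num.min y 1)); first exact: cst_continuous.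
by apply: (@continuous_min _ _ id (fun=> 1)); [exact: cvg_id|exact: cst_continuous].
Qed.

(** Precomposing with the projection [clamp] onto [0, 1] turns a map of the subtype into a total
    real function. *)
Definition ext (f : Icc R -> Icc R) x : R := iccval (f (clamp x)).

Lemma ext_continuous f : continuous (ext f).
Proof.
move=> x; apply: (@continuous_comp _ _ _ (fun x => f (clamp x)) (@iccval R)).
  by apply: continuous_comp; [exact: clamp_continuous|exact: cfun_continuous].
exact: iccval_continuous.
Qed.

Lemma ext0 f : ext f 0 = 0.
Proof. by rewrite /ext -[0 in LHS]/(iccval icc0) iccvalK cfun0. Qed.

Lemma ext1 f : ext f 1 = 1.
Proof. by rewrite /ext -[1 in LHS]/(iccval icc1) iccvalK cfun1. Qed.

Lemma ext_itv f x : 0 < x < 1 -> 0 < ext f x < 1.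
Proof. by move=> x01; apply: cfun_Ioo; rewrite clampK //; lra. Qed.

Lemma ext_cfunI f (x : Ioo R) : ext f (iooval x) = iooval (cfunI f x).
Proof.
rewrite /ext -[RHS]/(iccval (f (ioo_icc x))); congr (iccval (f _)).
exact: (iccvalK (ioo_icc x)).
Qed.

Lemma ext_le f x y : homeomorphism f -> 0 <= x <= 1 -> 0 <= y <= 1 ->
  (ext f x <= ext f y) = (x <= y).
Proof.
move=> [_ [k [_ fK _]]] x01 y01.
apply: (@segment_continuous_inj_le _ (ext f) 0 1); rewrite ?in_itv //=.
- by rewrite ext0 ext1.
- by apply: continuous_subspaceT; exact: ext_continuous.
move=> u v; rewrite !in_itv /= => u01 v01 /iccval_inj /(can_inj fK) /(congr1 iccval).
by rewrite !clampK.
Qed.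

(** The default [icc0] is never returned, since every element of [CI] is onto. This is a right
    inverse for any [f], and the true inverse once [f] is a homeomorphism. *)
Definition inv f y : R := iccval (xget icc0 [set x | f x = clamp y]).

Lemma invK f y : 0 <= y <= 1 -> ext f (inv f y) = y.
Proof.
move=> y01; rewrite /ext /inv iccvalK.
by rewrite (xgetPex icc0 (cfun_onto f (clamp y))) clampK.
Qed.

Lemma inv_itv f y : 0 < y < 1 -> 0 < inv f y < 1.
Proof.
move=> y01; have y01' : 0 <= y <= 1 by lra.
have /andP[a b] : 0 <= inv f y <= 1 by exact: iccval_itv.
rewrite !lt_neqAle a b !andbT; apply/andP; split; apply/eqP => e.
  by have := invK f y01'; rewrite -e ext0; lra.
by have := invK f y01'; rewrite e ext1; lra.
Qed.

Lemma inv_le f x y : homeomorphism f -> 0 <= x <= 1 -> 0 <= y <= 1 ->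
  (ext f x <= y) = (x <= inv f y).
Proof.
by move=> fh x01 y01; rewrite -[in LHS](invK f y01) ext_le //; exact: iccval_itv.
Qed.

Lemma inv_ge f x y : homeomorphism f -> 0 <= x <= 1 -> 0 <= y <= 1 ->
  (y <= ext f x) = (inv f y <= x).
Proof.
by move=> fh x01 y01; rewrite -[in LHS](invK f y01) ext_le //; exact: iccval_itv.
Qed.

Lemma inv_lt f x y : homeomorphism f -> 0 <= x <= 1 -> 0 <= y <= 1 ->
  (ext f x < y) = (x < inv f y).
Proof. by move=> fh x01 y01; rewrite !ltNge inv_ge. Qed.

Lemma inv_gt f x y : homeomorphism f -> 0 <= x <= 1 -> 0 <= y <= 1 ->
  (y < ext f x) = (inv f y < x).
Proof. by move=> fh x01 y01; rewrite !ltNge inv_le. Qed.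

(** * Inverses of nearby maps, compared through [h] *)

Lemma h_ext_d_C f g x : 0 < x < 1 -> `|h (ext f x) - h (ext g x)| <= d_C f g.
Proof.
move=> x01; have := d_C_ub f g (ioo_of x01).
by rewrite -!ext_cfunI.
Qed.

Lemma h_lt x y : 0 < x -> x < y -> y < 1 -> h x < h y.
Proof.
move=> x0 xy y1; have y0 : 0 < y by lra.
have a0 : 0 < 1 - x by lra.
have b0 : 0 < 1 - y by lra.
have lnlt u v : 0 < u -> u < v -> ln u < ln v :> R.
  by move=> u0 uv; rewrite ltr_ln ?posrE //; lra.
rewrite /h; case: (leP x) => x2; case: (leP y) => y2.
- by rewrite ltrD2r lnlt.
- have /= : ln x <= ln (2^-1 : R) by rewrite ler_ln ?posrE //; lra.
  have /= : ln (1 - y) < ln (2^-1 : R) by apply: lnlt; lra.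
  lra.
- lra.
- by rewrite ltrD2l ltrN2 lnlt //; lra.
Qed.

Lemma h_le_inv x y : 0 < x < 1 -> 0 < y < 1 -> h x <= h y -> x <= y.
Proof.
move=> x01 y01 hxy; rewrite leNgt; apply/negP => yx.
have : h y < h x by apply: h_lt; lra.
lra.
Qed.

Lemma h_onem x : 0 < x < 1 -> h (1 - x) = - h x.
Proof.
move=> x01; rewrite /h opprB addrCA subrr addr0.
case: (leP x) => x2; case: (leP (1 - x)) => x3; rewrite ?opprB //; last lra.
have -> : x = 2^-1 by lra.
have -> : 1 - 2^-1 = 2^-1 :> R by lra.
by rewrite subrr.
Qed.

(** With [w] the preimage of [x], the strict inequalities placing [x] between the images of [w - c]
    and [w + c] survive small changes of [f] in [d_C] and of [x]; monotonicity then traps [inv g y]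
    between [w - c] and [w + c]. *)
Lemma inv_jointly_continuous f x e : homeomorphism f -> 0 < x < 1 -> 0 < e ->
  exists2 d, 0 < d & forall g y, homeomorphism g -> d_C f g < d ->
    `|y - x| < d -> `|inv g y - inv f x| < e.
Proof.
move=> fh x01 e0; have x01' : 0 <= x <= 1 by lra.
have w01 := inv_itv f x01; set w := inv f x in w01 *.
pose c := Num.min (e / 2) (Num.min (w / 2) ((1 - w) / 2)).
have c0 : 0 < c by rewrite !lt_min; lra.
have ce : c <= e / 2 by rewrite ge_min lexx.
have cw : c <= w / 2 by rewrite !ge_min lexx !orbT.
have cw1 : c <= (1 - w) / 2 by rewrite !ge_min lexx !orbT.
have lo01 : 0 < w - c < 1 by lra.
have hi01 : 0 < w + c < 1 by lra.
have lox : ext f (w - c) < x by rewrite inv_lt // -/w; lra.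
have xhi : x < ext f (w + c) by rewrite inv_gt // -/w; lra.
have flo := ext_itv f lo01; have fhi := ext_itv f hi01.
(* [x1 < x < x2] separate [x] from the images of [w - c] and [w + c]. *)
pose x1 := (ext f (w - c) + x) / 2; pose x2 := (ext f (w + c) + x) / 2.
have h1 : h (ext f (w - c)) < h x1 by apply: h_lt; rewrite /x1; lra.
have h2 : h x2 < h (ext f (w + c)) by apply: h_lt; rewrite /x2; lra.
pose d := Num.min (Num.min (h x1 - h (ext f (w - c))) (h (ext f (w + c)) - h x2))
  (Num.min (x - x1) (x2 - x)).
have d0 : 0 < d by rewrite !lt_min !subr_gt0 h1 h2 /x1 /x2; lra.
exists d => // g y gh.
rewrite !lt_min => /andP[/andP[d1 d2] _] /andP[_ /andP[y1 y2]].
have glo := ext_itv g lo01; have ghi := ext_itv g hi01.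
have x101 : 0 < x1 < 1 by rewrite /x1; lra.
have x201 : 0 < x2 < 1 by rewrite /x2; lra.
have y01 : 0 <= y <= 1 by move: y1 y2; rewrite !ltr_norml; lra.
have glox1 : ext g (w - c) <= x1.
  apply: h_le_inv => //; have := h_ext_d_C f g lo01; rewrite ler_norml; lra.
have x2ghi : x2 <= ext g (w + c).
  apply: h_le_inv => //; have := h_ext_d_C f g hi01; rewrite ler_norml; lra.
have lo : w - c < inv g y by rewrite -inv_lt //; move: y1 y2; rewrite ?ltr_norml; lra.
have hi : inv g y < w + c by rewrite -inv_gt //; move: y1 y2; rewrite ?ltr_norml; lra.
rewrite ltr_norml; lra.
Qed.

(* Stated for real functions so as to apply at [1] after [x |-> 1 - x]. *)
Lemma expanding_near0 (phi : R -> R) (lam d : R) : 0 < lam -> 0 < d ->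
  (forall x, 0 < x < 1 -> 0 < phi x < 1) ->
  (forall e, 0 < e -> exists2 u, 0 < u & forall x, 0 < x < u -> `|phi x / x - lam| < e) ->
  exists2 y0, 0 < y0 < 1 & forall phi' : R -> R,
    (forall x, 0 < x < 1 -> 0 < phi' x < 1 /\ `|h (phi x) - h (phi' x)| <= d / 2) ->
    forall y, 0 < y < y0 ->
      y * expR (d - ln lam) < 1 /\ y <= phi' (y * expR (d - ln lam)).
Proof.
move=> lam0 d0 phi01 philim; set k := expR (d - ln lam).
have k0 : 0 < k by exact: expR_gt0.
(* The margin [d] is spent in two halves: one for the deviation of [phi X / X] from [lam], the other
   for passing from [phi] to [phi']. *)
pose q := expR (- (d / 2)).
have q0 : 0 < q by exact: expR_gt0.
have q1 : q < 1 by rewrite -expR0 ltr_expR; lra.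
have e0 : 0 < lam * (1 - q) by rewrite mulr_gt0 //; lra.
have [u u0 Hu] := philim _ e0.
(* The first term puts [X = y * k] below both [u] and 1; the second puts [y * expR (d / 2)] below
   1/2, where [h] is a shifted logarithm and the factor [expR (d / 2)] is a translation by
   [d / 2]. *)
pose y0 := Num.min (Num.min u 1 / k) (q / 2).
have y00 : 0 < y0 by rewrite lt_min !divr_gt0 // lt_min u0 ltr01.
have y0q : y0 <= q / 2 by rewrite ge_min lexx orbT.
exists y0; first by lra.
move=> phi' Hphi' y /andP[y0' yy0].
have : y < Num.min u 1 / k by apply: lt_le_trans yy0 _; rewrite ge_min lexx.
rewrite ltr_pdivlMr // lt_min => /andP[Xu X1].
split => //; set X := y * k in Xu X1 *.
have X0 : 0 < X by rewrite mulr_gt0.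
have X01 : 0 < X < 1 by rewrite X0.
have [pX01 hX] := Hphi' _ X01; have fX01 := phi01 _ X01.
have Xu' : 0 < X < u by rewrite X0.
have qq : q * expR (d / 2) = 1 by rewrite -expRD addNr expR0.
have r0 : 0 < expR (d / 2) by exact: expR_gt0.
have fX : y * expR (d / 2) <= phi X.
  have := Hu _ Xu'; rewrite ltr_norml => /andP[h1 _].
  have : lam * q <= phi X / X by lra.
  rewrite ler_pdivlMr // => /(le_trans _); apply.
  have -> : lam * q * X = y * (q * expR (d / 2)) * expR (d / 2).
    rewrite /X /k expRB lnK ?posrE // [in expR d](splitr d) expRD.
    by field; rewrite gt_eqF.
  by rewrite qq mulr1.
have y2 : y * expR (d / 2) <= 2^-1.
  have : y * expR (d / 2) <= q / 2 * expR (d / 2) by rewrite ler_pM2r //; lra.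
  by rewrite mulrAC qq div1r.
have yr0 : 0 < y * expR (d / 2) by rewrite mulr_gt0.
have hyr : h (y * expR (d / 2)) = h y + d / 2.
  have y2' : y <= 2^-1 by lra.
  by rewrite /h y2 y2' lnM ?posrE // expRK; ring.
have hle : h (y * expR (d / 2)) <= h (phi X).
  have [e|ne] := eqVneq (y * expR (d / 2)) (phi X); first by rewrite e.
  by apply/ltW/h_lt => //; [rewrite lt_neqAle ne | lra].
apply: h_le_inv => //; first lra.
move: hX; rewrite ler_norml; lra.
Qed.

Lemma ext_lim0 f (e : R) : 0 < e -> exists2 u, 0 < u &
  forall x, 0 < x < u -> `|ext f x / x - derivI f icc0| < e.
Proof.
move=> e0.
have cv : diffq f icc0 x @[x --> icc0^'] --> derivI f icc0 by exact: cfun_cvg0.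
move/cvgrPdist_lt : cv => /(_ _ e0); rewrite near_withinE => H.
have K0 : clamp 0 = icc0 by apply: iccval_inj; rewrite clampK // lexx ler01.
have cl : clamp x @[x --> (0 : R)] --> icc0.
  by rewrite -K0; exact: clamp_continuous.
have := cl _ H => /nbhs_ballP[u /= u0 Hu].
exists (Num.min u 1); first by rewrite lt_min u0 ltr01.
move=> x /andP[x0]; rewrite lt_min => /andP[xu x1].
have cx : iccval (clamp x) = x by apply: clampK; rewrite !ltW.
have := Hu x; rewrite /ball /= sub0r normrN gtr0_norm // => /(_ xu).
have -> : clamp x != icc0.
  by apply/eqP => /(congr1 iccval); rewrite cx => /= xE; move: x0; rewrite xE ltxx.
by rewrite /diffq cfun0 cx /= !subr0 distrC; apply.
Qed.

Lemma ext_lim1 f (e : R) : 0 < e -> exists2 u, 0 < u &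
  forall x, 0 < x < u -> `|(1 - ext f (1 - x)) / x - derivI f icc1| < e.
Proof.
move=> e0.
have cv : diffq f icc1 x @[x --> icc1^'] --> derivI f icc1 by exact: cfun_cvg1.
move/cvgrPdist_lt : cv => /(_ _ e0); rewrite near_withinE => H.
have K1 : clamp 1 = icc1 by apply: iccval_inj; rewrite clampK // lexx ler01.
have cl : clamp x @[x --> (1 : R)] --> icc1.
  by rewrite -K1; exact: clamp_continuous.
have := cl _ H => /nbhs_ballP[u /= u0 Hu].
exists (Num.min u 1); first by rewrite lt_min u0 ltr01.
move=> x /andP[x0]; rewrite lt_min => /andP[xu x1].
have cx : iccval (clamp (1 - x)) = 1 - x by apply: clampK; lra.
have := Hu (1 - x); rewrite /ball /= opprB addrC subrK gtr0_norm // => /(_ xu).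
have -> : clamp (1 - x) != icc1.
  by apply/eqP => /(congr1 iccval); rewrite cx -[iccval icc1]/(1 : R); lra.
rewrite /diffq cfun1 cx -[iccval (f _)]/(ext f (1 - x)) /= distrC.
have -> : 1 - x - 1 = - x by ring.
by rewrite invrN mulrN -mulNr opprB; apply.
Qed.

(** Near 0 the metric [d_C] controls ratios, so the derivative of [f] alone bounds the inverses of
    all [g] near [f]. *)
Lemma inv_near0 f d : 0 < d -> exists2 y0, 0 < y0 < 1 &
  forall g, homeomorphism g -> d_C f g <= d / 2 ->
    forall y, 0 < y < y0 -> inv g y <= y * expR (d - ln (derivI f icc0)).
Proof.
move=> d0; have [y0 y001 H] := expanding_near0 (cfun_deriv0 f) d0 (ext_itv f) (@ext_lim0 f).
exists y0 => // g gh gd y yy0; set X := y * _.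
have X0 : 0 < X by rewrite mulr_gt0 ?expR_gt0 //; lra.
have [x x01|X1 yX] := H (ext g) _ _ yy0.
  by split; [exact: ext_itv | apply: le_trans gd; exact: h_ext_d_C].
rewrite -/X in X1 yX.
by rewrite -inv_ge //; lra.
Qed.

Lemma inv_near1 f d : 0 < d -> exists2 y0, 0 < y0 < 1 &
  forall g, homeomorphism g -> d_C f g <= d / 2 ->
    forall y, 0 < y < y0 -> 1 - inv g (1 - y) <= y * expR (d - ln (derivI f icc1)).
Proof.
move=> d0.
have onem_itv x : 0 < x < 1 -> 0 < 1 - x < 1 by lra.
have phi01 x : 0 < x < 1 -> 0 < 1 - ext f (1 - x) < 1.
  by move=> x01; apply/onem_itv/ext_itv/onem_itv.
have [y0 y001 H] := expanding_near0 (cfun_deriv1 f) d0 phi01 (@ext_lim1 f).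
exists y0 => // g gh gd y yy0; set X := y * _.
have X0 : 0 < X by rewrite mulr_gt0 ?expR_gt0 //; lra.
have [x x01|X1 yX] := H (fun x => 1 - ext g (1 - x)) _ _ yy0.
  have x01' := onem_itv _ x01; split; first exact/onem_itv/ext_itv.
  rewrite !h_onem ?ext_itv // opprK addrC distrC; apply: le_trans gd.
  exact: h_ext_d_C.
rewrite -/X in X1 yX.
have : 1 - X <= inv g (1 - y) by rewrite -inv_le //; lra.
lra.
Qed.

End real_extension.

(** * Distribution functions and weak convergence *)

Section distribution_function.
Context {R : realType}.
Implicit Types (mu nu : M1 R).

Lemma iooval_continuous : continuous (@iooval R).
Proof. exact: initial_continuous. Qed.

Lemma open_measurable_Ioo (A : set (Ioo R)) : open A ->
  measurable (A : set (borelIoo R)).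
Proof. exact: sub_sigma_algebra. Qed.

Lemma continuous_measurable_Ioo (xi : Ioo R -> R) : continuous xi ->
  measurable_fun [set: borelIoo R] (xi : borelIoo R -> R).
Proof.
move=> /continuousP cxi; apply: (measurability _ (RGenOpens.measurableE R)).
move=> _ [_ [a [b ->] <-]]; rewrite setTI; apply: open_measurable_Ioo.
exact/cxi/interval_open.
Qed.

Definition Ioo_le (x : R) : set (borelIoo R) := [set y : Ioo R | iooval y <= x].

Lemma measurable_Ioo_le x : measurable (Ioo_le x).
Proof.
rewrite -[Ioo_le x]setCK; apply: measurableC.
have -> : ~` Ioo_le x = @iooval R @^-1` `]x, +oo[%classic.
  apply/seteqP; split=> y /=; rewrite in_itv /= andbT ltNge; first by move/negP.
  by move=> /negP.
apply: open_measurable_Ioo; move/continuousP: iooval_continuous; apply.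
exact: interval_open.
Qed.

Definition mu_cdf mu (x : R) : R := fine (mu (Ioo_le x)).

Lemma mu_cdfE mu x : mu (Ioo_le x) = (mu_cdf mu x)%:E.
Proof. by rewrite /mu_cdf fineK // fin_num_measure //; exact: measurable_Ioo_le. Qed.

Lemma mu_cdf_itv mu x : 0 <= mu_cdf mu x <= 1.
Proof.
rewrite -!lee_fin -mu_cdfE measure_ge0 /=.
by apply: probability_le1; exact: measurable_Ioo_le.
Qed.

Lemma mu_cdf_le mu x y : x <= y -> mu_cdf mu x <= mu_cdf mu y.
Proof.
move=> xy; rewrite -lee_fin -!mu_cdfE; apply: le_measure;
  rewrite ?inE; try exact: measurable_Ioo_le.
by move=> z /= /le_trans; apply.
Qed.

(** The sets [Ioo_le n.+1%:R^-1] decrease to the empty set, so continuity from above applies. The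
    rate depends on [mu]; a uniform one comes later from stationarity. *)
Lemma mu_cdf_near0 mu (e : R) : 0 < e ->
  exists2 u, 0 < u & forall x, x <= u -> mu_cdf mu x <= e.
Proof.
move=> e0.
have : (fun n : nat => mu (Ioo_le n.+1%:R^-1)) x @[x --> \oo] --> 0%E.
  rewrite -(measure0 mu).
  have <- : \bigcap_n Ioo_le (n.+1%:R^-1 : R) = set0.
    rewrite -subset0 => y yn /=.
    have /andP[y0 _] := iooval_itv y.
    have := yn (Num.truncn (iooval y)^-1) I; rewrite /Ioo_le /= leNgt => /negP; apply.
    rewrite -[ltRHS]invrK ltf_pV2 ?posrE ?invr_gt0 //.
    exact: truncnS_gt.
  apply: nonincreasing_cvg_mu.
  - by rewrite (le_lt_trans (probability_le1 _ _)) ?ltry //; exact: measurable_Ioo_le.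
  - by move=> n; exact: measurable_Ioo_le.
  - by apply: bigcap_measurable => // n _; exact: measurable_Ioo_le.
  - move=> m n mn; apply/subsetPset => y /= /le_trans; apply.
    by rewrite lef_pV2 ?posrE // ler_nat.
under eq_fun do rewrite mu_cdfE.
move=> /fine_cvgP[_] /cvgrPdist_le /(_ _ e0) [N _ /(_ N (leqnn N))] /=.
rewrite sub0r normrN ger0_norm; last by have /andP[] := mu_cdf_itv mu (N.+1%:R^-1).
move=> H; exists N.+1%:R^-1; first by rewrite invr_gt0.
by move=> x xN; apply: le_trans H; exact: mu_cdf_le.
Qed.

Lemma mu_cdf_near1 mu (e : R) : 0 < e ->
  exists2 u, 0 < u & forall x, 1 - x <= u -> 1 - mu_cdf mu x <= e.
Proof.
move=> e0.
have : (fun n : nat => mu (Ioo_le (1 - n.+1%:R^-1))) x @[x --> \oo] --> 1%E.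
  rewrite -(probability_setT mu).
  have <- : \bigcup_n Ioo_le (1 - n.+1%:R^-1 : R) = setT.
    rewrite -subTset => y _ /=.
    have /andP[_ y1] := iooval_itv y.
    have y0 : 0 < 1 - iooval y by rewrite subr_gt0.
    exists (Num.truncn (1 - iooval y)^-1) => //; rewrite /Ioo_le /= lerBrDr -lerBrDl.
    rewrite -[leRHS]invrK lef_pV2 ?posrE ?invr_gt0 //.
    by rewrite ltW // truncnS_gt.
  apply: nondecreasing_cvg_mu.
  - by move=> n; exact: measurable_Ioo_le.
  - by apply: bigcup_measurable => // n _; exact: measurable_Ioo_le.
  - move=> m n mn; apply/subsetPset => y /= /le_trans; apply.
    by rewrite lerD2l lerN2 lef_pV2 ?posrE // ler_nat.
under eq_fun do rewrite mu_cdfE.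
move=> /fine_cvgP[_] /cvgrPdist_le /(_ _ e0) [N _ /(_ N (leqnn N))] /=.
rewrite ger0_norm; last by rewrite subr_ge0; have /andP[] := mu_cdf_itv mu (1 - N.+1%:R^-1).
move=> H; exists N.+1%:R^-1; first by rewrite invr_gt0.
move=> x xN; apply: le_trans H; rewrite lerD2l lerN2.
by apply: mu_cdf_le; rewrite lerBlDr -lerBlDl.
Qed.

(** * Integrals of bounded measurable functions *)

Definition mu_int (s : borelIoo R -> R) mu : R := \int[mu]_x s x.

Definition bounded_mfun (s : borelIoo R -> R) :=
  measurable_fun setT s /\ exists K, forall x, `|s x| <= K.

Lemma bounded_mfun_integrable mu s : bounded_mfun s -> mu.-integrable setT (EFin \o s).
Proof.
move=> [ms [K HK]]; apply: measurable_bounded_integrable => //.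
  by rewrite (le_lt_trans (probability_le1 _ _)) ?ltry.
exists K; split; first exact: num_real.
by move=> M KM x _ /=; apply: le_trans (HK x) (ltW KM).
Qed.

Lemma bounded_mfun_cst (c : R) : bounded_mfun (fun=> c).
Proof. by split; [exact: measurable_cst | exists `|c|]. Qed.

Lemma bounded_mfun_Ioo_le x : bounded_mfun \1_(Ioo_le x).
Proof.
split; first by apply: measurable_indic; exact: measurable_Ioo_le.
by exists 1 => y; rewrite indicE; case: (_ \in _); rewrite ?normr1 ?normr0.
Qed.

Lemma bounded_mfunD s t : bounded_mfun s -> bounded_mfun t ->
  bounded_mfun (fun x => s x + t x).
Proof.
move=> [ms [K HK]] [mt [L HL]]; split; first exact: measurable_funD.
by exists (K + L) => x; apply: le_trans (ler_normD _ _) _; rewrite lerD.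
Qed.

Lemma bounded_mfunZ c s : bounded_mfun s -> bounded_mfun (fun x => c * s x).
Proof.
move=> [ms [K HK]]; split; first exact: measurable_funM.
by exists (`|c| * K) => x; rewrite normrM ler_wpM2l.
Qed.

Lemma mu_int_cst c mu : mu_int (fun=> c) mu = c.
Proof.
rewrite /mu_int Rintegral_cst // [X in fine X](_ : _ = 1%E) ?mulr1 //.
exact: probability_setT.
Qed.

Lemma mu_int_Ioo_le x mu : mu_int \1_(Ioo_le x) mu = mu_cdf mu x.
Proof.
by rewrite /mu_int /Rintegral integral_indic ?setIT //; exact: measurable_Ioo_le.
Qed.

Lemma mu_intD s t mu : bounded_mfun s -> bounded_mfun t ->
  mu_int (fun x => s x + t x) mu = mu_int s mu + mu_int t mu.
Proof. by move=> bs bt; apply: RintegralD => //; exact: bounded_mfun_integrable. Qed.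

Lemma mu_intZ c s mu : bounded_mfun s -> mu_int (fun x => c * s x) mu = c * mu_int s mu.
Proof. by move=> bs; apply: RintegralZl => //; exact: bounded_mfun_integrable. Qed.

Lemma mu_int_norm_le s t w mu : bounded_mfun s -> bounded_mfun t -> bounded_mfun w ->
  (forall y, `|s y - t y| <= w y) -> `|mu_int s mu - mu_int t mu| <= mu_int w mu.
Proof.
move=> bs bt bw stw.
have bst := bounded_mfunD bs (bounded_mfunZ (-1) bt).
have -> : mu_int s mu - mu_int t mu = mu_int (fun y => s y + -1 * t y) mu.
  by rewrite mu_intD ?mu_intZ ?mulN1r //; exact: bounded_mfunZ.
apply: le_trans (le_normr_Rintegral _ (bounded_mfun_integrable mu bst)) _ => //.
apply: le_Rintegral => //.
- case: bst => mst [K HK]; apply: bounded_mfun_integrable; split.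
    exact: measurableT_comp.
  by exists K => y; rewrite normr_id.
- exact: bounded_mfun_integrable.
by move=> y _; rewrite mulN1r.
Qed.

(** * From pointwise convergence of distribution functions to weak convergence *)

Section portmanteau.
Variables (G : set_system (M1 R)) (mu : M1 R).
Context {FG : Filter G}.
Hypothesis cdf_cvg : forall x, 0 < x < 1 -> mu_cdf nu x @[nu --> G] --> mu_cdf mu x.

Definition convergent (s : borelIoo R -> R) :=
  bounded_mfun s /\ mu_int s nu @[nu --> G] --> mu_int s mu.

Lemma convergent0 : convergent (fun=> 0).
Proof.
split; first exact: bounded_mfun_cst.
have -> : mu_int (fun=> 0) = fun=> 0 by apply/funext => nu; rewrite mu_int_cst.
exact: cvg_cst.
Qed.

Lemma convergentD s t : convergent s -> convergent t -> convergent (fun x => s x + t x).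
Proof.
move=> [bs cs] [bt ct]; split; first exact: bounded_mfunD.
have -> : mu_int (fun x => s x + t x) = fun nu => mu_int s nu + mu_int t nu.
  by apply/funext => nu; rewrite mu_intD.
exact: cvgD.
Qed.

Lemma convergentZ c s : convergent s -> convergent (fun x => c * s x).
Proof.
move=> [bs cs]; split; first exact: bounded_mfunZ.
have -> : mu_int (fun x => c * s x) = fun nu => c * mu_int s nu.
  by apply/funext => nu; rewrite mu_intZ.
by apply: cvgM => //; exact: cvg_cst.
Qed.

Lemma convergent_Ioo_le x : 0 < x < 1 -> convergent \1_(Ioo_le x).
Proof.
move=> x01; split; first exact: bounded_mfun_Ioo_le.
have -> : mu_int \1_(Ioo_le x) = mu_cdf^~ x by apply/funext => nu; rewrite mu_int_Ioo_le.
exact: cdf_cvg.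
Qed.

Lemma indic_Ioo_le x (y : Ioo R) : \1_(Ioo_le x) y = (iooval y <= x)%R%:R :> R.
Proof.
rewrite indicE; congr (_%:R); apply: congr1.
by apply/idP/idP; rewrite inE.
Qed.

(** Continuous induction along [u, v]: at the supremum [z] of the points reached, continuity of [xi]
    lets an approximation ending just before [z] be prolonged past [z] by the constant value of [xi]
    at [z]. *)
Lemma step_approx (xi : bcfun) (e u v : R) : 0 < e -> 0 < u -> u < v -> v < 1 ->
  exists2 s, convergent s & forall y : Ioo R,
    if u < iooval y <= v then `|xi y - s y| <= e else s y == 0.
Proof.
move=> e0 u0 uv v1.
pose S := [set x | u <= x <= v /\ exists2 s, convergent s & forall y : Ioo R,
    if u < iooval y <= x then `|xi y - s y| <= e else s y == 0].
have Su : S u.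
  split; first by rewrite lexx ltW.
  by exists (fun=> 0); [exact: convergent0 | move=> y; case: ltP => //= uy; rewrite leNgt uy].
have hsS : has_sup S by split; [exists u | exists v => x [/andP[]]].
set z := sup S.
have uz : u <= z by apply: ub_le_sup => //; exact: hsS.2.
have zv : z <= v by apply: ge_sup; [exists u | move=> x [/andP[]]].
have z01 : 0 < z < 1 by lra.
have [d d0 Hd] : exists2 d, 0 < d & forall y : Ioo R,
    `|iooval y - z| < d -> `|xi y - xi (ioo_of z01)| <= e.
  have /cvgrPdist_le /(_ _ e0) := @bcfun_continuous _ xi (ioo_of z01).
  rewrite nbhsE /= => -[U [[V oV VU] Uz] HU]; rewrite -VU /= in Uz.
  have /nbhs_ballP[d /= d0 Hd] := open_nbhs_nbhs (conj oV Uz).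
  exists d => // y yz; rewrite distrC; apply: HU; rewrite -VU /=; apply: Hd.
  by rewrite /ball /= distrC.
have zd : z - d < z by lra.
have [x [xuv [s cs Hs]] xz] := sup_gt (ex_intro _ _ Su) zd.
have xz' : x <= z by apply: ub_le_sup; [exact: hsS.2 | split=> //; exists s].
pose t := Num.min (z + d / 2) v.
have tv : t <= v by rewrite ge_min lexx orbT.
have td : t <= z + d / 2 by rewrite ge_min lexx.
have zt : z <= t by rewrite le_min zv; lra.
suff St : S t.
  have tz : t <= z by apply: ub_le_sup => //; exact: hsS.2.
  have tE : t = v by move: tz; rewrite /t; case: (leP (z + d / 2) v) => //; lra.
  by case: St => _; rewrite tE.
split; first by lra.
(* The added term is the value at [z] times the indicator of (x, t]. *)
exists (fun y => s y + xi (ioo_of z01) * (\1_(Ioo_le t) y + -1 * \1_(Ioo_le x) y)).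
  apply: convergentD => //; apply: convergentZ; apply: convergentD.
    by apply: convergent_Ioo_le; lra.
  by apply: convergentZ; apply: convergent_Ioo_le; lra.
move=> y; have := Hs y; rewrite !indic_Ioo_le.
have [yx|xy] := leP (iooval y) x.
  have yt : iooval y <= t by lra.
  by rewrite yt mulN1r subrr mulr0 addr0.
rewrite andbF => /eqP ->; rewrite mulr0 addr0 add0r.
have uy : u < iooval y by lra.
rewrite uy /=; case: leP => yt; last by rewrite mulr0.
rewrite mulr1; apply: Hd; rewrite ltr_norml; lra.
Qed.

Lemma weak_cvg_cdf : G --> mu.
Proof.
apply/weak_cvgP => xi; rewrite -/(mu_int xi); apply/cvgrPdist_le => e e0.
have [K0 HK0] := bcfun_bounded xi; pose K := `|K0| + 1.
have K1 : 1 <= K by rewrite lerDr.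
have HK x : `|xi x| <= K.
  by apply: le_trans (HK0 x) _; apply: le_trans (ler_norm _) _; rewrite lerDl.
(* The final count is [3 * r] for replacing [xi] by [s] under [mu], [5 * r] under [nu], and [r]
   between the two integrals of [s]. *)
pose r := e / 10; have r0 : 0 < r by rewrite divr_gt0.
have K0' : 0 < K by lra.
have rK0 : 0 < r / K by rewrite divr_gt0.
have [u' u'0 Hu'] := mu_cdf_near0 mu rK0; have [v' v'0 Hv'] := mu_cdf_near1 mu rK0.
(* The caps 1/3 and 2/3 ensure [u < v]. *)
pose u : R := Num.min u' 3^-1; pose v : R := Num.max (1 - v') (2 / 3).
have u0 : 0 < u by rewrite lt_min u'0 invr_gt0 ltr0n.
have u1 : u <= 3^-1 by rewrite ge_min lexx orbT.
have v1 : v < 1 by rewrite gt_max; lra.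
have v0 : 2 / 3 <= v by rewrite le_max lexx orbT.
have uv : u < v by lra.
have Hu : mu_cdf mu u <= r / K by apply: Hu'; rewrite ge_min lexx.
have Hv : 1 - mu_cdf mu v <= r / K.
  by apply: Hv'; rewrite lerBlDr addrC -lerBlDr le_max lexx.
have [s cs Hs] := step_approx xi r0 u0 uv v1.
have [bs /cvgrPdist_le /(_ _ r0) cvs] := cs.
have u01 : 0 < u < 1 by lra.
have v01 : 0 < v < 1 by lra.
have /cvgrPdist_le /(_ _ rK0) cvu := cdf_cvg u01.
have /cvgrPdist_le /(_ _ rK0) cvv := cdf_cvg v01.
(* [w] dominates the error of [s]: at most [r] on (u, v], and at most [K] outside, where [s]
   vanishes. *)
pose w (y : borelIoo R) := r + K * (\1_(Ioo_le u) y + (1 + -1 * \1_(Ioo_le v) y)).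
have bI := bounded_mfun_Ioo_le.
have bc := bounded_mfun_cst.
have bv : bounded_mfun (fun y => 1 + -1 * \1_(Ioo_le v) y).
  exact/bounded_mfunD/bounded_mfunZ.
have buv := bounded_mfunD (bI u) bv.
have Ew nu : mu_int w nu = r + K * (mu_cdf nu u + (1 - mu_cdf nu v)).
  rewrite mu_intD ?mu_intZ ?mu_intD ?mu_intZ ?mu_int_cst ?mu_int_Ioo_le ?mulN1r //.
    exact: bounded_mfunZ.
  exact: bounded_mfunZ.
have est nu : `|mu_int xi nu - mu_int s nu| <= r + K * (mu_cdf nu u + (1 - mu_cdf nu v)).
  rewrite -Ew; apply: mu_int_norm_le => //.
  - split; last by exists K.
    by apply: continuous_measurable_Ioo; exact: bcfun_continuous.
  - exact/bounded_mfunD/bounded_mfunZ.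
move=> y; have := Hs y; rewrite /w !indic_Ioo_le.
  have [yu|uy] := leP (iooval y) u.
    have -> : iooval y <= v by lra.
    by move=> /eqP ->; rewrite subr0; have := HK y; lra.
  have [yv|vy] := leP (iooval y) v => /=; first lra.
  by move=> /eqP ->; rewrite subr0; have := HK y; lra.
near=> nu.
have c1 : `|mu_int s mu - mu_int s nu| <= r by near: nu.
have c2 : `|mu_cdf mu u - mu_cdf nu u| <= r / K by near: nu.
have c3 : `|mu_cdf mu v - mu_cdf nu v| <= r / K by near: nu.
have em : K * (mu_cdf mu u + (1 - mu_cdf mu v)) <= 2 * r.
  have -> : 2 * r = K * (r / K + r / K) by field; rewrite gt_eqF.
  by rewrite ler_pM2l //; lra.
have en : K * (mu_cdf nu u + (1 - mu_cdf nu v)) <= 4 * r.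
  have -> : 4 * r = K * (4 * (r / K)) by field; rewrite gt_eqF.
  by rewrite ler_pM2l //; move: c2 c3; rewrite !ler_norml; lra.
have := est mu; have := est nu; move: c1; rewrite !ler_norml.
have -> : e = 10 * r by rewrite /r; field.
rewrite -[weak_eval xi mu]/(mu_int xi mu); lra.
Unshelve. all: by end_near. Qed.

End portmanteau.
End distribution_function.

(** * Stationary measures *)

Section tails.
Context {R : realType}.

(** In logarithmic scale the steps are at most [d - ln lam0] and [d - ln lam1], with mean at most
    [- L / 2] for all [p] within [d] of [p0]; one exponent then serves in [harmonic_le_powR]. The
    point is the uniformity: [u] is chosen before [F], [a], [b] and [p]. *)
Lemma harmonic_tail (lam0 lam1 p0 : R) : 0 < lam0 -> 0 < lam1 ->
  0 < p0 * ln lam0 + (1 - p0) * ln lam1 ->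
  exists2 d, 0 < d & forall y0, 0 < y0 < 1 -> forall e, 0 < e ->
    exists2 u, 0 < u < 1 & forall (F a b : R -> R) (p : R),
      (forall x, F x <= 1) ->
      (forall e, 0 < e -> exists2 v, 0 < v & forall x, 0 < x < v -> F x <= e) ->
      0 <= p <= 1 -> `|p0 - p| <= d ->
      (forall x, 0 < x < 1 -> F x = p * F (a x) + (1 - p) * F (b x)) ->
      (forall x, 0 < x < 1 -> 0 < a x < 1) -> (forall x, 0 < x < 1 -> 0 < b x < 1) ->
      (forall y, 0 < y < y0 -> a y <= y * expR (d - ln lam0)) ->
      (forall y, 0 < y < y0 -> b y <= y * expR (d - ln lam1)) ->
      forall x, 0 < x < u -> F x <= e.
Proof.
move=> l0 l1; set L := _ + _ => L0.
pose K := `|ln lam0 - ln lam1|; have K0 : 0 <= K by exact: normr_ge0.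
(* The mean step is at most [d - L + d * K], and this choice makes it equal to [- L / 2]. *)
pose d := L / (2 * (1 + K)).
have d0 : 0 < d by rewrite divr_gt0 // mulr_gt0 //; lra.
have dE : d * (1 + K) = L / 2 by rewrite /d; field; rewrite gt_eqF //; lra.
have L20 : 0 < L / 2 by lra.
have [al [rho [al0 rho1 Hrho]]] := exponent_exists (d - ln lam0) (d - ln lam1) L20.
exists d => // y0 /andP[y00 y01] e e0.
pose q := Num.min 2^-1 (e `^ al^-1).
have q0 : 0 < q by rewrite lt_min powR_gt0 // invr_gt0 ltr0n.
have q1 : q <= 2^-1 by rewrite ge_min lexx.
exists (y0 * q).
  rewrite mulr_gt0 //=; have : y0 * q <= 1 * 2^-1 by rewrite ler_pM // ltW.
  lra.
move=> F a b p F1 F0 p01 pd harm a01 b01 Ha Hb x /andP[x0 xu].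
have y0q : y0 * q <= y0 by rewrite ger_pMr //; lra.
have xy0 : 0 < x < y0 by lra.
have y001 : 0 < y0 <= 1 by lra.
have bound k y z : 0 < z -> 0 < y -> z <= y * expR k -> z `^ al <= expR (al * k) * y `^ al.
  move=> z0 yp zy; have k0 : 0 <= expR k by exact: expR_ge0.
  have -> : expR (al * k) * y `^ al = (y * expR k) `^ al.
    by rewrite powRM ?expR_ge0 ?(ltW yp) // -expRM (mulrC k) [RHS]mulrC.
  by apply: ge0_ler_powR; rewrite ?nnegrE ?mulr_ge0 ?(ltW al0) ?(ltW z0) ?(ltW yp).
apply: le_trans (harmonic_le_powR F1 F0 p01 harm a01 b01 al0 rho1 y001 _ xy0) _.
  move=> y yy0; have yy1 : 0 < y < 1 by lra.
  have yp : 0 < y by lra.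
  have /andP[ay _] := a01 _ yy1; have /andP[by_ _] := b01 _ yy1.
  have ba := bound _ _ _ ay yp (Ha _ yy0); have bb := bound _ _ _ by_ yp (Hb _ yy0).
  have p0' : 0 <= p by lra.
  have p1' : 0 <= 1 - p by lra.
  apply: (@le_trans _ _ ((p * expR (al * (d - ln lam0)) +
      (1 - p) * expR (al * (d - ln lam1))) * y `^ al)).
    by rewrite [leRHS]mulrDl -!mulrA lerD // ler_wpM2l.
  rewrite ler_wpM2r ?powR_ge0 //; apply: Hrho => //.
  have -> : p * (d - ln lam0) + (1 - p) * (d - ln lam1) =
      d - L + (p0 - p) * (ln lam0 - ln lam1) by rewrite /L; ring.
  have : (p0 - p) * (ln lam0 - ln lam1) <= d * K.
    apply: le_trans (ler_norm _) _; rewrite normrM ler_wpM2r //.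
  lra.
have -> : e = (e `^ al^-1) `^ al by rewrite -powRrM mulVf ?gt_eqF // powRr1 // ltW.
have xq : x / y0 <= e `^ al^-1.
  rewrite ler_pdivrMr // mulrC; apply/ltW/(lt_le_trans xu).
  by rewrite ler_pM2l // ge_min lexx orbT.
apply: ge0_ler_powR => //; rewrite ?nnegrE ?powR_ge0 ?divr_ge0 ?ltW //.
Qed.

Lemma d_C0_d_m (f g : RDS R) : d_C (rds0 f) (rds0 g) <= d_m f g.
Proof. by rewrite /d_m le_max lexx. Qed.

Lemma d_C1_d_m (f g : RDS R) : d_C (rds1 f) (rds1 g) <= d_m f g.
Proof. by rewrite /d_m !le_max lexx orbT. Qed.

Lemma rdsp_d_m (f g : RDS R) : `|rdsp f - rdsp g| <= d_m f g.
Proof. by rewrite /d_m !le_max lexx !orbT. Qed.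

Lemma preimage_Ioo_le (f : CI R) x : homeomorphism f -> 0 < x < 1 ->
  cfunI f @^-1` Ioo_le x = Ioo_le (inv f x).
Proof.
move=> fh x01; apply/seteqP; split=> y /=; rewrite /Ioo_le /= -ext_cfunI inv_le //;
  have := iooval_itv y; lra.
Qed.

Lemma stationary_cdf (f : RDS R) (mu : M1 R) x : stationary f mu -> 0 < x < 1 ->
  mu_cdf mu x = rdsp f * mu_cdf mu (inv (rds0 f) x) + (1 - rdsp f) * mu_cdf mu (inv (rds1 f) x).
Proof.
move=> st x01; apply: EFin_inj; rewrite EFinD !EFinM -!mu_cdfE.
rewrite (st _ (measurable_Ioo_le x)).
by rewrite !preimage_Ioo_le //; [exact: rds1_homeo | exact: rds0_homeo].
Qed.

Lemma stationary_tail0 (f : RDS R) (e : R) : 0 < e -> exists2 d, 0 < d &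
  exists2 u, 0 < u < 1 & forall (g : RDS R) mu x, d_m f g < d -> stationary g mu ->
    0 < x < u -> mu_cdf mu x <= e.
Proof.
move=> e0.
have [d d0 H] := harmonic_tail (cfun_deriv0 (rds0 f)) (cfun_deriv0 (rds1 f)) (rds_Lambda0 f).
have [y0 y001 H0] := inv_near0 (rds0 f) d0.
have [y1 y101 H1] := inv_near0 (rds1 f) d0.
have y2 : 0 < Num.min y0 y1 < 1 by rewrite lt_min gt_min; lra.
have [u u01 Hu] := H _ y2 _ e0.
(* [inv_near0] asks for maps within [d / 2], while [harmonic_tail] only asks for weights within
   [d]. *)
exists (d / 2); first by lra.
exists u => // g mu x gd st xu.
have hg0 := rds0_homeo g; have hg1 := rds1_homeo g.
apply: (Hu (mu_cdf mu) (inv (rds0 g)) (inv (rds1 g)) (rdsp g)) => //.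
- by move=> z; have /andP[] := mu_cdf_itv mu z.
- move=> e' e'0; have [v v0 Hv] := mu_cdf_near0 mu e'0.
  by exists v => // z zv; apply: Hv; lra.
- by have := rdsp_itv g; lra.
- by have := rdsp_d_m f g; lra.
- by move=> z z01; exact: stationary_cdf.
- by move=> z z01; exact: inv_itv.
- by move=> z z01; exact: inv_itv.
- move=> y /andP[yp]; rewrite lt_min => /andP[yy0 yy1]; apply: H0 => //; last by rewrite yp.
  by have := d_C0_d_m f g; lra.
- move=> y /andP[yp]; rewrite lt_min => /andP[yy0 yy1]; apply: H1 => //; last by rewrite yp.
  by have := d_C1_d_m f g; lra.
Qed.

(** The reflected function [1 - mu_cdf mu (1 - z)] satisfies the same equation for the inverses
    conjugated by [z |-> 1 - z], which reduces this end to [harmonic_tail] as well. *)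
Lemma stationary_tail1 (f : RDS R) (e : R) : 0 < e -> exists2 d, 0 < d &
  exists2 u, 0 < u < 1 & forall (g : RDS R) mu x, d_m f g < d -> stationary g mu ->
    0 < 1 - x < u -> 1 - mu_cdf mu x <= e.
Proof.
move=> e0.
have [d d0 H] := harmonic_tail (cfun_deriv1 (rds0 f)) (cfun_deriv1 (rds1 f)) (rds_Lambda1 f).
have [y0 y001 H0] := inv_near1 (rds0 f) d0.
have [y1 y101 H1] := inv_near1 (rds1 f) d0.
have y2 : 0 < Num.min y0 y1 < 1 by rewrite lt_min gt_min; lra.
have [u u01 Hu] := H _ y2 _ e0.
exists (d / 2); first by lra.
exists u => // g mu x gd st xu.
have hg0 := rds0_homeo g; have hg1 := rds1_homeo g.
have onem_inv (k : CI R) z : 0 < z < 1 -> 0 < 1 - inv k (1 - z) < 1.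
  move=> z01; have z01' : 0 < 1 - z < 1 by lra.
  by have := inv_itv k z01'; lra.
have := Hu (fun z => 1 - mu_cdf mu (1 - z)) (fun z => 1 - inv (rds0 g) (1 - z))
   (fun z => 1 - inv (rds1 g) (1 - z)) (rdsp g) _ _ _ _ _ _ _ _ _ (1 - x).
rewrite subKr; apply => //.
- by move=> z; have /andP[] := mu_cdf_itv mu (1 - z); lra.
- move=> e' e'0; have [v v0 Hv] := mu_cdf_near1 mu e'0.
  by exists v => // z zv; apply: Hv; lra.
- by have := rdsp_itv g; lra.
- by have := rdsp_d_m f g; lra.
- move=> z z01; rewrite !subKr (stationary_cdf st); last lra.
  by ring.
- by move=> z; exact: onem_inv.
- by move=> z; exact: onem_inv.
- move=> y /andP[yp]; rewrite lt_min => /andP[yy0 yy1]; apply: H0 => //; last by rewrite yp.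
  by have := d_C0_d_m f g; lra.
- move=> y /andP[yp]; rewrite lt_min => /andP[yy0 yy1]; apply: H1 => //; last by rewrite yp.
  by have := d_C1_d_m f g; lra.
Qed.

(** Arbitrarily small oscillation means joint continuity in the system and the point; taking both
    systems equal to [f], it includes continuity of the distribution function of [psi f] at [x]. The
    inverse of [rds1 f] is the map that moves points down, as the maximum principle requires. *)
Lemma cdf_continuous (psi : RDS R -> M1 R) (f : RDS R) (x e : R) :
  (forall g, stationary g (psi g)) -> 0 < x < 1 -> 0 < e ->
  osc_le (d_m f) (fun g => mu_cdf (psi g)) x e.
Proof.
move=> st x01 e0.
apply: (@osc_le_small R (RDS R) (d_m f) (fun g => mu_cdf (psi g)) rdsp (rdsp f)
  (fun g => inv (rds0 g)) (fun g => inv (rds1 g)) (inv (rds0 f)) (inv (rds1 f))) => //.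
- by move=> g z; exact: mu_cdf_itv.
- exact: rdsp_itv.
- by move=> g; rewrite distrC; exact: rdsp_d_m.
- by move=> g z z01; exact: stationary_cdf.
- move=> z r z01 r0; have [d d0 Hd] := inv_jointly_continuous (rds0_homeo f) z01 r0.
  exists d => // g y gd; apply: Hd; first exact: rds0_homeo.
  exact: le_lt_trans (d_C0_d_m f g) gd.
- move=> z r z01 r0; have [d d0 Hd] := inv_jointly_continuous (rds1_homeo f) z01 r0.
  exists d => // g y gd; apply: Hd; first exact: rds1_homeo.
  exact: le_lt_trans (d_C1_d_m f g) gd.
- by move=> z; exact: inv_itv.
- move=> z z01; have /andP[-> _] := inv_itv (rds1 f) z01.
  have z01' : 0 <= z <= 1 by lra.
  rewrite -inv_gt //; last exact: rds1_homeo.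
  by have := @rds1_gt _ f (clamp z); rewrite clampK //; apply.
- move=> r r0; have [d d0 [u u01 Hu]] := stationary_tail0 f r0.
  (* The window around [z] stays inside (0, u), where both distribution functions lie in [0, r]. *)
  exists u => // z zu; exists (Num.min d (Num.min z (u - z))).
    by rewrite !lt_min d0; lra.
  move=> g g' y y'; rewrite !lt_min => /andP[gd _] /andP[gd' _].
  move=> /andP[_ /andP[y1 y2]] /andP[_ /andP[y1' y2']].
  have yu : 0 < y < u by move: y1 y2; rewrite !ltr_norml; lra.
  have yu' : 0 < y' < u by move: y1' y2'; rewrite !ltr_norml; lra.
  have := Hu _ _ _ gd (st g) yu; have := Hu _ _ _ gd' (st g') yu'.
  by have := mu_cdf_itv (psi g) y; have := mu_cdf_itv (psi g') y'; rewrite ler_norml; lra.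
- move=> r r0; have [d d0 [u u01 Hu]] := stationary_tail1 f r0.
  exists (1 - u); first lra.
  move=> z zu; exists (Num.min d (Num.min (1 - z) (z - (1 - u)))).
    by rewrite !lt_min d0; lra.
  move=> g g' y y'; rewrite !lt_min => /andP[gd _] /andP[gd' _].
  move=> /andP[_ /andP[y1 y2]] /andP[_ /andP[y1' y2']].
  have yu : 0 < 1 - y < u by move: y1 y2; rewrite !ltr_norml; lra.
  have yu' : 0 < 1 - y' < u by move: y1' y2'; rewrite !ltr_norml; lra.
  have := Hu _ _ _ gd (st g) yu; have := Hu _ _ _ gd' (st g') yu'.
  by have := mu_cdf_itv (psi g) y; have := mu_cdf_itv (psi g') y'; rewrite ler_norml; lra.
Qed.

End tails.

Theorem theorem5p1 (R : realType) (psi : RDS R -> M1 R)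
    (hpsi : forall f : RDS R, stationary f (psi f)) :
  continuous psi.
Proof.
move=> f; have nf := nbhs_filter f.
apply: weak_cvg_cdf => x x01; apply/cvgrPdist_le => e e0.
have [d d0 Hd] := cdf_continuous f hpsi x01 e0.
apply/nbhs_ballP; exists d => //= g; rewrite ballEmdist /= => fg.
(* Both points are [x], and one of the two systems is [f] itself. *)
by apply: Hd; rewrite ?subrr ?normr0 // d_mxx.
Qed.
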